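(* For any integer $n\geq 1$ and any partition $\nu\vdash n$, the coefficients $a^{\lambda}_{n,\nu}(\alpha)$ (for $\lambda\vdash n$) verify $$\mathrm{Aut}_\nu \sum_{\lambda \vdash n}z_\lambda^{-1}\alpha^{-\ell(\lambda)}a^{\lambda}_{n,\nu}(\alpha)\,p_\lambda = \frac{1}{\prod_{i \geq 1} \nu_i!}\left(\prod_{i\geq 2}\Omega_{\nu_i}\right)\Delta^{\nu_1-1}(p_1/\alpha),$$ where products of operators denote composition, the product $\prod_{i\ge 2}\Omega_{\nu_i}=\Omega_{\nu_2}\Omega_{\nu_3}\cdots\Omega_{\nu_{\ell(\nu)}}$ running over the parts of $\nu$ other than $\nu_1$.
   Context: Partitions: $\lambda=(\lambda_1,\dots,\lambda_p)\vdash n$ has parts in decreasing order, $\ell(\lambda)=p$, $m_i(\lambda)$ is the number of parts equal to $i$, $z_\lambda=\prod_i i^{m_i(\lambda)}m_i(\lambda)!$ and $\mathrm{Aut}_\lambda=\prod_i m_i(\lambda)!$. $\mathcal P$ is the set of all partitions (including the empty one). The one-part partition $(n)$ is written simply $n$ when used as an index. Jack functions: $\alpha$ is an indeterminate, symmetric functions have coefficients in $\mathbb{Q}(\alpha)$, $p_\lambda$ are the power sums, $\langle p_\lambda,p_\mu\rangle_\alpha=\alpha^{\ell(\lambda)}z_\lambda\delta_{\lambda,\mu}$. $J^\alpha_\lambda$ is the Jack symmetric function in its usual integral normalization: the $J_\lambda^\alpha$ are orthogonal for $\langle\cdot,\cdot\rangle_\alpha$, $J^\alpha_\lambda$ is a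 combination of monomial functions $m_\mu$ with $\mu\le\lambda$ in dominance order, and the coefficient of $m_{1^{n}}$ in $J^\alpha_\lambda$ is $n!$ for $\lambda \vdash n$. The coefficients $a^\lambda_{\mu,\nu}(\alpha)$ (for $\lambda,\mu,\nu\vdash n$) are defined by $$\sum_{\gamma\in\mathcal P}\frac{J^\alpha_\gamma(x)J^\alpha_\gamma(y)J^\alpha_\gamma(z)t^{|\gamma|}}{\langle J^\alpha_\gamma,J^\alpha_\gamma\rangle_\alpha}=\sum_{n\ge0}t^n\sum_{\lambda,\mu,\nu\vdash n}\alpha^{-\ell(\lambda)}z_\lambda^{-1}a^\lambda_{\mu,\nu}(\alpha)p_\lambda(x)p_\mu(y)p_\nu(z).$$ Operators: the Laplace-Beltrami operator is $$D_\alpha=\frac{\alpha}{2}\sum_i x_i^2\frac{\partial^2}{\partial x_i^2}+\sum_{i\ne j}\frac{x_ix_j}{x_i-x_j}\frac{\partial}{\partial x_i},$$ which on symmetric functions, in terms of power sums, reads $$D_\alpha=\frac{\alpha-1}{2}\sum_{i\ge1} i(i-1)p_i\frac{\partial}{\partial p_i}+\frac{\alpha}{2}\sum_{i,j\ge1}ij\,p_{i+j}\frac{\partial}{\partial p_i}\frac{\partial}{\partial p_j}+\frac12\sum_{i,j\ge1}(i+j)p_ip_j\frac{\partial}{\partial p_{i+j}}.$$ With $[A,B]=AB-BA$ and $p_1/\alpha$ denoting, inside commutators, the operator of multiplication by $p_1/\alpha$, put $\Delta=[D_\alpha,[D_\alpha,p_1/\alpha]]$, $\Omega_1=[D_\alpha,p_1/\alpha]$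 and $\Omega_{k+1}=[\Delta,\Omega_k]$ for $k\ge1$. *)

(* Defs.v *)
From HB Require Import structures.
From mathcomp Require Import all_boot all_order all_algebra.
From mathcomp Require Import fraction.
From mathcomp Require Import finmap.
From mathcomp Require Import monalg.

Set Implicit Arguments.
Unset Strict Implicit.
Unset Printing Implicit Defensive.

Import GRing.Theory.
Local Open Scope ring_scope.

(* Integer partitions *)

Definition is_partition (n : nat) (s : seq nat) : bool :=
  [&& sorted geq s, 0%N \notin s & sumn s == n].

Record intpartn (n : nat) : Type :=
  IntPartn { parts :> seq nat; _ : is_partition n parts }.

HB.instance Definition _ n := [isSub for @parts n].
HB.instance Definition _ n := [Countable of intpartn n by <:].

Definition intpartn_code n (p : intpartn n) : {bseq n of 'I_n.+1} :=
  insub_bseq n (map inord p).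
Definition intpartn_decode n (b : {bseq n of 'I_n.+1}) : option (intpartn n) :=
  insub (map val b).

Lemma intpartn_codeK n : pcancel (@intpartn_code n) (@intpartn_decode n).
Proof.
case=> s hs; have /and3P[_ s0 /eqP ss] := hs.
have sz : (size s <= n)%N.
  rewrite -ss; elim: s s0 {hs ss} => //= -[|x] s IH; rewrite in_cons //= => /IH.
  by move=> h; rewrite addSn ltnS (leq_trans h) // leq_addl.
have bd x : x \in s -> (x <= n)%N.
  rewrite -ss; elim: s {hs s0 ss sz} => //= y s IH; rewrite in_cons.
  case/predU1P=> [->|/IH h]; first exact: leq_addr.
  by rewrite (leq_trans h) // leq_addl.
have E : map val (intpartn_code (IntPartn hs)) = s.
  rewrite /intpartn_code /insub_bseq /insubd insubT ?size_map //= => _.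
  rewrite -map_comp.
  rewrite -[RHS]map_id; apply/eq_in_map => x xs /=.
  by rewrite inordK // ltnS bd.
by rewrite /intpartn_decode E insubT; congr Some; apply: val_inj.
Qed.

HB.instance Definition _ n :=
  isFinite.Build (intpartn n) (pcan_enumP (@intpartn_codeK n)).

Lemma row_partn_subproof n : is_partition n (nseq (0 < n) n).
Proof. by case: n => // n; rewrite /is_partition /= addn0 eqxx. Qed.

(* The one-part partition (n); for n = 0 this is the empty partition. *)
Definition row_partn n : intpartn n := IntPartn (row_partn_subproof n).

Lemma col_partn_subproof n : is_partition n (nseq n 1%N).
Proof.
apply/and3P; split; last by rewrite sumn_nseq mul1n.
- by case: n => //= n; elim: n.
- by rewrite mem_nseq andbF.
Qed.

Definition col_partn n : intpartn n := IntPartn (col_partn_subproof n).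

Definition z_part (s : seq nat) : nat :=
  (\prod_(i <- undup s) (i ^ count_mem i s * (count_mem i s)`!))%N.

Definition aut_part (s : seq nat) : nat :=
  (\prod_(i <- undup s) (count_mem i s)`!)%N.

Definition dominated (s t : seq nat) : Prop :=
  forall k, (sumn (take k s) <= sumn (take k t))%N.

Lemma malgUM (R : comNzRingType) (M : monomType) (k1 k2 : M) :
  << k1 >> * << k2 >> = << mmul k1 k2 >> :> {malg R[M]}.
Proof. by rewrite malgM_def fgmulUU mulr1. Qed.

(* Symmetric functions over a field K; the Jack parameter alpha is an element
   of K, to be instantiated with the indeterminate of Q(alpha). *)

Section SymmetricFunctions.

Variable K : fieldType.

(* The algebra of symmetric functions, as the polynomial algebra over K in
   the algebraically independent power sums p_1, p_2, ...; the variable of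
   index i : nat stands for p_(i+1). *)
Definition symf := {malg K[{cmonom nat}]}.

HB.instance Definition _ := GRing.ComAlgebra.on symf.

(* Meaningful for k > 0 only. *)
Definition psum (k : nat) : symf := << ucm k.-1 >>.

Definition psum_part (s : seq nat) : symf := \prod_(k <- s) psum k.

(* The algebra morphism sending p_k to q k for k > 0. *)
Definition psubst (S : comAlgType K) (q : nat -> S) (f : symf) : S :=
  mmap (in_alg S) (fun m : {cmonom nat} => \prod_(i <- finsupp m) q i.+1 ^+ m i) f.

(* f(x_1, ..., x_N), where p_k = x_1^k + ... + x_N^k. *)
Definition symf_eval (N : nat) (f : symf) : {malg K[{cmonom 'I_N}]} :=
  psubst (fun k => \sum_(i < N) << ucm i >> ^+ k) f.

(* m_mu(x_1, ..., x_N): the sum of all distinct monomials whose nonzero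
   exponents are, up to order, the parts of mu. *)
Definition monomial_eval (N : nat) (mu : seq nat) : {malg K[{cmonom 'I_N}]} :=
  \sum_(e : {ffun 'I_N -> 'I_(sumn mu).+1}
         | perm_eq [seq k <- [seq val (e i) | i <- enum 'I_N] | k != 0%N] mu)
     \prod_(i < N) << ucm i >> ^+ e i.

(* f = \sum_mu c_mu m_mu as symmetric functions, that is, in any finite number
   of variables. *)
Definition monomial_expansion (n : nat) (f : symf) (c : intpartn n -> K) : Prop :=
  forall N, symf_eval N f = \sum_(mu : intpartn n) c mu *: monomial_eval N mu.

Variable alpha : K.

(* The parts, in no particular order, of the partition lambda such that the
   monomial m in the power sums is p_lambda. *)
Definition mon_parts (m : {cmonom nat}) : seq nat :=
  flatten [seq nseq (m i) i.+1 | i <- finsupp m].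

(* The bilinear form with <p_lambda, p_mu> = alpha^l(lambda) z_lambda if
   lambda = mu and 0 otherwise; see jack_scalar_psum. *)
Definition jack_scalar (f g : symf) : K :=
  \sum_(m <- msupp f)
     (alpha ^+ size (mon_parts m) * (z_part (mon_parts m))%:R * f@_m * g@_m).

Lemma count_mon_parts m k : count_mem k (mon_parts m) = ((0 < k) * m k.-1)%N.
Proof.
rewrite /mon_parts count_flatten -map_comp sumnE big_map.
have -> : (\sum_(i <- finsupp m) (count_mem k \o (fun i => nseq (m i) i.+1)) i
   = \sum_(i <- finsupp m) (i.+1 == k) * m i)%N.
  by apply: eq_bigr => i _ /=; rewrite count_nseq.
case: k => [|k]; first by rewrite big1.
rewrite mul1n /=; case: (boolP (k \in finsupp m)) => hk; last first.
  rewrite big_seq big1 => [|i hi].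
    by move: hk; rewrite -cmE_eq0 => /eqP ->.
  by case: eqP hi hk => // -[->] ->.
rewrite (bigD1_seq k) //= ?fset_uniq // eqxx mul1n big1 ?addn0 // => i.
by rewrite eqSS => /negPf ->.
Qed.

Lemma psum_partE s :
  psum_part s = << \big[mmul/mone]_(k <- s) ucm k.-1 >> :> symf.
Proof.
rewrite /psum_part; elim: s => [|k s IH]; first by rewrite !big_nil.
by rewrite [LHS]big_cons [in RHS]big_cons IH -malgUM.
Qed.

Lemma perm_mon_parts (s : seq nat) : 0%N \notin s ->
  perm_eq (mon_parts (\big[mmul/mone]_(k <- s) ucm k.-1)) s.
Proof.
move=> s0; apply/allP => k _; apply/eqP; rewrite count_mon_parts.
case: k => [|k]; first by rewrite (count_memPn s0).
rewrite mul1n /=; elim: s s0 => [|[|j] s IH]; first by rewrite big_nil cm1.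
  by rewrite in_cons.
by rewrite in_cons /= => s0; rewrite big_cons cmM cmU /= IH // eqSS.
Qed.

Lemma perm_z_part (s t : seq nat) : perm_eq s t -> z_part s = z_part t.
Proof.
move=> st; rewrite /z_part (perm_big (undup t)) /=; last first.
  apply: uniq_perm; rewrite ?undup_uniq // => x.
  by rewrite !mem_undup (perm_mem st).
by apply: eq_bigr => i _; rewrite (permP st).
Qed.

Lemma jack_scalar_mon (m m' : {cmonom nat}) :
  jack_scalar << m >> << m' >>
  = alpha ^+ size (mon_parts m) * (z_part (mon_parts m))%:R * (m' == m)%:R.
Proof.
rewrite /jack_scalar msuppU1 big_seq_fset1 [X in _ * X * _]mcoeffUU mulr1.
by rewrite [X in _ * X]mcoeffU1.
Qed.

Lemma jack_scalar_psum m n (lambda : intpartn m) (mu : intpartn n) :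
  jack_scalar (psum_part lambda) (psum_part mu)
  = if lambda == mu :> seq nat
    then alpha ^+ size lambda * (z_part lambda)%:R else 0.
Proof.
have /and3P[sl l0 _] : is_partition m lambda := valP lambda.
have /and3P[sm m0 _] : is_partition n mu := valP mu.
rewrite !psum_partE jack_scalar_mon.
rewrite (perm_size (perm_mon_parts l0)) (perm_z_part (perm_mon_parts l0)).
have [->|ne] := eqVneq (lambda : seq nat) mu; first by rewrite eqxx mulr1.
case: eqP => [E|]; last by rewrite mulr0.
case/eqP: ne; apply: (sorted_eq (leT := geq)) => //.
- by move=> x y z /= h1 h2; apply: leq_trans h2 h1.
- by move=> x y /=; rewrite andbC -eqn_leq => /eqP.
rewrite -(permPl (perm_mon_parts l0)) -E; exact: perm_mon_parts.
Qed.

Record is_jack (J : forall n, intpartn n -> symf) : Prop := IsJack {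
  jack_orthogonal : forall m n (lambda : intpartn m) (mu : intpartn n),
    (lambda : seq nat) <> mu -> jack_scalar (J m lambda) (J n mu) = 0;
  jack_triangular : forall n (lambda : intpartn n),
    exists c : intpartn n -> K,
      [/\ monomial_expansion (J n lambda) c,
          forall mu : intpartn n, c mu != 0 -> dominated mu lambda
        & c (col_partn n) = n`!%:R]
}.

(* Polynomials in the power sums p_k(x), p_k(y), p_k(z) of three alphabets,
   indexed by 0, 1, 2 : 'I_3. *)
Definition symf3 := {malg K[{cmonom ('I_3 * nat)%type}]}.

HB.instance Definition _ := GRing.ComAlgebra.on symf3.

Definition in_alphabet (i : 'I_3) (f : symf) : symf3 :=
  psubst (fun k => << ucm (i, k.-1) >> : symf3) f.

Definition tensor3 (f g h : symf) : symf3 :=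
  in_alphabet (inord 0) f * in_alphabet (inord 1) g * in_alphabet (inord 2) h.

(* a n lambda mu nu is a^lambda_{mu,nu}; the identity of formal power series
   in t is stated as the equality of the coefficients of t^n. *)
Definition is_jack_structure_coef (J : forall n, intpartn n -> symf)
    (a : forall n, intpartn n -> intpartn n -> intpartn n -> K) : Prop :=
  forall n,
    \sum_(gamma : intpartn n)
       (jack_scalar (J n gamma) (J n gamma))^-1
         *: tensor3 (J n gamma) (J n gamma) (J n gamma)
    = \sum_(lambda : intpartn n) \sum_(mu : intpartn n) \sum_(nu : intpartn n)
       (alpha ^- size lambda * (z_part lambda)%:R^-1 * a n lambda mu nu)
         *: tensor3 (psum_part lambda) (psum_part mu) (psum_part nu).

(* Operators *)

Definition dpsum (k : nat) (f : symf) : symf :=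
  \sum_(m <- msupp f) << f@_m *+ m k.-1 *g divcm m (ucm k.-1) >>.

Lemma mcoeff_dpsum k f m :
  (dpsum k f)@_m = f@_(mmul m (ucm k.-1)) *+ (m k.-1).+1.
Proof.
rewrite /dpsum raddf_sum /= [in RHS](monalgE f) raddf_sum /= -sumrMnl.
apply: eq_bigr => m' _; rewrite !mcoeffU -!mulrnA.
case: (eqVneq m' (mmul m (ucm k.-1))) => [->|ne].
  have -> : divcm (mmul m (ucm k.-1)) (ucm k.-1) = m.
    by apply/eqP/cmP => i; rewrite divcmE cmM addnK.
  by rewrite eqxx cmM cmUU addn1 mul1n muln1.
case: (posnP (m' k.-1)) => [->|h]; first by rewrite !mul0n.
case: eqP => [E|]; last by rewrite muln0.
case/eqP: ne; apply/eqP/cmP => i; rewrite -E cmM divcmE cmU.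
by case: eqP => [<-|]; rewrite ?subnK // subn0 addn0.
Qed.

(* The largest k such that p_k occurs in f (0 if f is constant). *)
Definition psum_bound (f : symf) : nat :=
  (\max_(m <- msupp f) \max_(i <- finsupp m) i.+1)%N.

(* The Laplace-Beltrami operator, with all sums restricted to i, j <= N. *)
Definition laplace_beltrami_upto (N : nat) (f : symf) : symf :=
  ((alpha - 1) / 2) *: (\sum_(1 <= i < N.+1) (psum i * dpsum i f) *+ (i * (i - 1)))
  + (alpha / 2) *: (\sum_(1 <= i < N.+1) \sum_(1 <= j < N.+1)
                      (psum (i + j) * dpsum i (dpsum j f)) *+ (i * j))
  + 2^-1 *: (\sum_(1 <= i < N.+1) \sum_(1 <= j < N.+1)
               (psum i * psum j * dpsum (i + j) f) *+ (i + j)).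

(* The omitted terms of the infinite sums vanish; see laplace_beltramiE. *)
Definition laplace_beltrami (f : symf) : symf :=
  laplace_beltrami_upto (psum_bound f) f.

Lemma mcoeff_psum_bound k f m : (psum_bound f < k)%N ->
  f@_(mmul m (ucm k.-1)) = 0.
Proof.
case: k => // k; rewrite ltnS => hk; apply: mcoeff_outdom; apply/negP => hm.
have: (k < psum_bound f)%N; last by rewrite ltnNge hk.
apply: leq_trans (leq_bigmax_seq _ hm isT).
by rewrite (leq_bigmax_seq (F := succn)) // -cmE_neq0 cmM cmUU addn1.
Qed.

Lemma laplace_beltramiE N f : (psum_bound f <= N)%N ->
  laplace_beltrami f = laplace_beltrami_upto N f.
Proof.
move=> hN; set B := psum_bound f.
have d0 k : (B < k)%N -> dpsum k f = 0.
  by move=> hk; apply/malgP => m; rewrite mcoeff_dpsum mcoeff_psum_bound ?mul0rn ?mcoeff0.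
have d00 i j : (B < i)%N || (B < j)%N -> dpsum i (dpsum j f) = 0.
  case/orP => h; apply/malgP => m; rewrite !mcoeff_dpsum mcoeff0.
    by rewrite -mulmA [mmul (ucm _) _]mulmC mulmA mcoeff_psum_bound ?mul0rn.
  by rewrite mcoeff_psum_bound ?mul0rn.
have trunc (F : nat -> symf) : (forall i, (B < i)%N -> F i = 0) ->
    \sum_(1 <= i < N.+1) F i = \sum_(1 <= i < B.+1) F i.
  move=> F0; rewrite (@big_cat_nat _ _ _ B.+1) //= [X in _ + X]big_nat.
  by rewrite [X in _ + X]big1 ?addr0 // => i /andP[h _]; rewrite F0.
rewrite /laplace_beltrami /laplace_beltrami_upto -/B.
apply: f_equal2; [apply: f_equal2|]; apply: f_equal.
- by rewrite trunc // => i h; rewrite d0 // mulr0 mul0rn.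
- rewrite trunc => [|i h].
    apply: eq_bigr => i _; rewrite trunc // => j h.
    by rewrite d00 ?h ?orbT // mulr0 mul0rn.
  by rewrite big1 // => j _; rewrite d00 ?h // mulr0 mul0rn.
- rewrite trunc => [|i h].
    apply: eq_bigr => i _; rewrite trunc // => j h.
    by rewrite d0 ?ltn_addl // mulr0 mul0rn.
  by rewrite big1 // => j _; rewrite d0 ?ltn_addr // mulr0 mul0rn.
Qed.

Definition commutator (A B : symf -> symf) (f : symf) : symf := A (B f) - B (A f).

Definition p1_alpha : symf := alpha^-1 *: psum 1.

Definition Omega1 : symf -> symf := commutator laplace_beltrami ( *%R p1_alpha).

Definition Delta : symf -> symf := commutator laplace_beltrami Omega1.

(* Meaningful for k > 0 only. *)
Definition Omega (k : nat) : symf -> symf := iter k.-1 (commutator Delta) Omega1.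

End SymmetricFunctions.

Arguments psum {K} k.
Arguments psum_part {K} s.

Definition Qalpha : fieldType := {fraction {poly rat}}.

Definition alpha : Qalpha := tofrac 'X.

(* Main.v *)
Require Import Defs.
From HB Require Import structures.
From mathcomp Require Import all_boot all_order all_algebra.
From mathcomp Require Import perm generic_quotient fraction.
From mathcomp Require Import finmap.
From mathcomp Require Import monalg.
From mathcomp Require Import zify ring.
Import GRing.Theory Num.Theory.
Local Open Scope ring_scope.

Set Implicit Arguments.
Unset Strict Implicit.
Unset Printing Implicit Defensive.

(** Put q_k = p_k / (alpha k) and let B be the scalar product.  Extracting the
    coefficients of p_n(y) and p_nu(z) from the triple Cauchy series turns the
    left-hand side into the sum over gamma of
      B(q_n, J_gamma) B(q_nu, J_gamma) / B(J_gamma, J_gamma) J_gamma,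
    where q_nu is the product of the q_(nu_i) ([series_content_op]).  This is
    the image of q_nu under the operator Phi ([content_op]) that is diagonal in
    the Jack basis with eigenvalue B(q_n, J_gamma).

    That eigenvalue is the product of the alpha-contents of the boxes of gamma
    other than the corner ([B_qsum]).  The Laplace-Beltrami operator D is also
    diagonal, its eigenvalue being the sum of the same contents ([D_J]), and
    q_1 J_gamma only involves diagrams with one more box ([pieri]).  Hence each
    commutator with D multiplies a matrix entry of the multiplication by q_1 by
    the content of the added box, and so does the passage through Phi: in
    positive degree Phi q_1 = Omega_1 Phi and Phi Omega_1 = Delta Phi.  Since
    (k+1) q_(k+1) = [Omega_1, q_k], it follows that Phi q_k = Omega_k Phi / k!
    ([content_op_qsumM]); and Phi(q_k) = Delta^(k-1)(q_1) / k!, because Omega_1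
    annihilates the constants ([content_op_qsum]).  Taking the factors of q_nu
    off one by one gives the right-hand side.

    The facts about Jack functions come from the functions g_n defined by
    sum_n g_n t^n = exp (sum_k p_k t^k / (alpha k)).  The coefficient of m_mu in
    f is the pairing of f with g_mu ([monomial_expansion_coef]), D acts on
    products of g's by an explicit raising formula ([polar_jackg_rec]), and D is
    self-adjoint, which makes the J_lambda eigenfunctions.  An eigenfunction
    that is triangular for the dominance order is determined by its leading
    term, because comparable partitions have different eigenvalues; therefore
    the adjoint of the multiplication by g_k, with k the first row of gamma,
    removes that row from J_gamma ([row_removal]).  The Pieri rule follows by
    induction on the number of rows, since the adjoint of q_1 is the derivation
    d_1, which takes g_k to g_(k-1) / alpha.

    Everything except the passage to coefficients of monomials depends only on
    the relations between the power sums p_k, the derivations d_k and the form,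
    and is stated for any commutative algebra with such data. *)

(** * Partitions and dominance *)

Lemma intpartnP n (la : intpartn n) : [/\ sorted geq la, 0%N \notin (la : seq nat) & sumn la = n].
Proof. by have /and3P[? ? /eqP] := valP la. Qed.

Lemma sumn_intpartn n (la : intpartn n) : sumn la = n.
Proof. by have [] := intpartnP la. Qed.

Lemma intpartn_neq0 n (la : intpartn n) : 0%N \notin (la : seq nat).
Proof. by have [] := intpartnP la. Qed.

Lemma intpartn_inj n (la mu : intpartn n) : la = mu :> seq nat -> la = mu.
Proof. exact: val_inj. Qed.

Lemma geq_trans : transitive geq.
Proof. by move=> y x z /= h1 h2; apply: leq_trans h2 h1. Qed.

(** Zero parts are dropped: they matter in exponent vectors and in the raising
    operators, where a part may be lowered to 0. *)
Lemma sort_partn n (s : seq nat) : sumn s = n ->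
  exists la : intpartn n, perm_eq [seq k <- s | k != 0%N] la.
Proof.
move=> sn; have hp : is_partition n (sort geq [seq k <- s | k != 0%N]).
  apply/and3P; split.
  - by apply: sort_sorted => x y /=; apply: leq_total.
  - by rewrite mem_sort mem_filter.
  - rewrite (perm_sumn (permEl (perm_sort _ _))) -sn.
    by elim: (s) => //= -[|k] t IH //=; rewrite (eqP IH).
by exists (IntPartn hp) => /=; rewrite perm_sym perm_sort.
Qed.

Lemma size_le_sumn (s : seq nat) : 0%N \notin s -> (size s <= sumn s)%N.
Proof. by elim: s => //= -[|k] s IH; rewrite inE //= => /IH; lia. Qed.

Lemma partial_sums_inj (s t : seq nat) : 0%N \notin s -> 0%N \notin t ->
  (forall k, sumn (take k s) = sumn (take k t)) -> s = t.
Proof.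
elim: s t => [|x s IH] [|y t] //=.
- by move=> _; rewrite inE; case: y => //= y _ /(_ 1%N) /=; rewrite take0 addn0.
- by rewrite inE; case: x => //= x _ _ /(_ 1%N) /=; rewrite take0 addn0.
rewrite !inE !negb_or => /andP[_ s0] /andP[_ t0] e.
have exy := e 1%N; rewrite /= !take0 !addn0 in exy; rewrite exy.
congr (_ :: _); apply: IH => // k; have := e k.+1; rewrite /= exy; lia.
Qed.

Lemma eq_partial_sums (s t : seq nat) : size s = size t ->
  (forall k, sumn (take k s) = sumn (take k t)) -> s = t.
Proof.
elim: s t => [|x s IH] [|y t] //= [st] e.
have exy := e 1%N; rewrite /= !take0 !addn0 in exy; rewrite exy.
congr (_ :: _); apply: IH => // k; have := e k.+1; rewrite /= exy; lia.
Qed.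

(** A strictly increasing function for the dominance order; it serves as the
    measure of inductions along that order and, through the complementary
    statistic [leg_sum], separates the eigenvalues of comparable partitions. *)
Definition dom_weight n (s : seq nat) : nat := \sum_(k < n.+1) sumn (take k s).

Lemma dominated_weight n s t : dominated s t -> (dom_weight n s <= dom_weight n t)%N.
Proof. by move=> st; apply: leq_sum => k _; apply: st. Qed.

(** All the partial sums agree as soon as their totals do. *)
Lemma dominated_eq n (la mu : intpartn n) : dominated la mu ->
  (dom_weight n mu <= dom_weight n la)%N -> la = mu.
Proof.
move=> dlm wle; apply: intpartn_inj; apply: partial_sums_inj.
- exact: intpartn_neq0.
- exact: intpartn_neq0.
have E (k : 'I_n.+1) : sumn (take k la) = sumn (take k mu).
  have := sumnB (index_enum 'I_n.+1) (fun (k : 'I_n.+1) (_ : true) => dlm k).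
  rewrite -/(dom_weight n la) -/(dom_weight n mu).
  move: wle; rewrite -subn_eq0 => /eqP -> /eqP; rewrite sum_nat_eq0.
  by move=> /forallP/(_ k) /=; rewrite subn_eq0 => h; apply/anti_leq; rewrite dlm h.
move=> k; case: (leqP k n) => [le_kn|lt_nk]; first by have := E (inord k); rewrite inordK.
have sz (ka : intpartn n) : (size ka <= k)%N.
  have := size_le_sumn (intpartn_neq0 ka); rewrite sumn_intpartn; lia.
by rewrite !take_oversize ?sz // !sumn_intpartn.
Qed.

(** The statistic usually written n(s), the sum of (i-1) s_i. *)
Fixpoint leg_sum (s : seq nat) : nat := if s is _ :: s' then sumn s' + leg_sum s' else 0.
(** The statistic n of the conjugate partition. *)
Fixpoint arm_sum (s : seq nat) : nat := if s is k :: s' then 'C(k, 2) + arm_sum s' else 0.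

Lemma leg_sum_drop M s : (size s <= M)%N ->
  leg_sum s = (\sum_(k < M) sumn (drop k.+1 s))%N.
Proof.
elim: s M => [|k s IH] M /=; first by rewrite big1.
case: M => // M le_sM; rewrite big_ord_recl /= drop0 (IH M) //.
Qed.

Lemma dom_weight_leg n (la : intpartn n) :
  (dom_weight n la + leg_sum la)%N = (n * n)%N.
Proof.
have sz : (size la <= n)%N.
  by have := size_le_sumn (intpartn_neq0 la); rewrite sumn_intpartn.
rewrite (leg_sum_drop sz) /dom_weight big_ord_recl take0 add0n -big_split /=.
rewrite (eq_bigr (fun=> n)) ?sum_nat_const ?card_ord // => i _.
by rewrite -sumn_cat cat_take_drop sumn_intpartn.
Qed.

Definition dominatedb (s t : seq nat) :=
  [forall k : 'I_(size s + size t).+1, (sumn (take k s) <= sumn (take k t))%N].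

Lemma dominatedP s t : reflect (dominated s t) (dominatedb s t).
Proof.
apply: (iffP forallP) => [h k|h k]; last exact: h.
case: (leqP k (size s + size t)) => [le_k|lt_k].
  by have := h (inord k); rewrite inordK.
have := h (inord (size s + size t)); rewrite inordK //.
by rewrite !take_oversize //; lia.
Qed.

Lemma dominated_trans s t u : dominated s t -> dominated t u -> dominated s u.
Proof. by move=> st tu k; apply: leq_trans (st k) (tu k). Qed.

Lemma dominated_anti n (la mu : intpartn n) :
  dominated la mu -> dominated mu la -> la = mu.
Proof. by move=> d1 d2; apply/(dominated_eq d1)/dominated_weight. Qed.

Lemma dominated_head (s t : seq nat) : dominated s t -> (head 0%N s <= head 0%N t)%N.
Proof. by move=> /(_ 1%N); case: s t => [|x s] [|y t] //=; rewrite ?take0 ?addn0. Qed.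

Lemma behead_partn m n (la : intpartn n) (s : seq nat) k : la = k :: s :> seq nat ->
  sumn s = m -> [/\ (0 < k)%N, n = (k + m)%N & exists mu : intpartn m, mu = s :> seq nat].
Proof.
have [so l0 sl] := intpartnP la => e sm; rewrite e /= in so l0 sl.
have hp : is_partition m s.
  rewrite /is_partition (path_sorted so) sm eqxx andbT.
  by move: l0; rewrite inE negb_or => /andP[].
split; [|by rewrite -sl sm|by exists (IntPartn hp)].
by move: l0; case: (k).
Qed.

Lemma sumn_incr_nth s i : sumn (incr_nth s i) = (sumn s).+1.
Proof.
elim: s i => [|k s IH] [|i] //=; last by rewrite IH addnS.
by rewrite sumn_ncons.
Qed.

(** Either the largest part x belongs to t and is removed from both sides, or
    some part of t is at most x and is traded for it. *)
Lemma sumn_take_sorted (mu t u : seq nat) k : sorted geq mu ->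
  perm_eq (t ++ u) mu -> (size t <= k)%N -> (sumn t <= sumn (take k mu))%N.
Proof.
elim: mu t u k => [|x mu IH] t u k so.
  by case: t => //= y t /perm_size.
move=> tu le_k; case: t tu le_k => [|y t] //= tu; case: k => // k; rewrite ltnS => le_k.
have so' := path_sorted so.
have le_x z : z \in mu -> (z <= x)%N.
  by apply/allP: z; apply: (order_path_min geq_trans so).
rewrite /=; case: (boolP (x \in y :: t)) => [xt|xt].
  have e := perm_to_rem xt; rewrite (perm_sumn e : (y + sumn t)%N = _) /= leq_add2l.
  apply: (IH _ u) => //; last by have := perm_size e; rewrite /= => -[<-].
  apply/seq.permP => P; have := seq.permP tu P; have := seq.permP e P.
  by rewrite /= !count_cat /=; lia.
have xu : x \in u.
  by have := perm_mem tu x; rewrite -cat_cons mem_cat (negPf xt) inE eqxx.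
have e : perm_eq (t ++ y :: rem x u) mu.
  apply/seq.permP => P; have := seq.permP tu P; have := seq.permP (perm_to_rem xu) P.
  by rewrite /= !count_cat /=; lia.
apply: leq_add; last exact: (IH _ (y :: rem x u)).
by apply: le_x; rewrite -(perm_mem e) mem_cat inE eqxx orbT.
Qed.

Lemma dominated_sort (s mu : seq nat) : sorted geq mu ->
  perm_eq [seq k <- s | k != 0%N] mu -> dominated s mu.
Proof.
move=> so e k; have sum0 (t : seq nat) : sumn [seq i <- t | i != 0%N] = sumn t.
  by elim: t => //= -[|i] t IH //=; rewrite IH.
rewrite -(sum0 (take k s)).
apply: (@sumn_take_sorted _ _ [seq i <- drop k s | i != 0%N]) => //.
  by rewrite -filter_cat cat_take_drop.
by rewrite size_filter (leq_trans (count_size _ _)) // size_take; case: ltnP.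
Qed.

(** * The algebra of symmetric functions in power sums *)

Section PowerSums.
Variables (K : fieldType) (alpha : K).

(** The monomial in the power sums that is their product over the parts of s. *)
Definition monom_of (s : seq nat) : {cmonom nat} :=
  \big[mmul/mone]_(k <- s) ucm k.-1.

Lemma mon_parts_neq0 m : 0%N \notin mon_parts m.
Proof. by rewrite -has_pred1 has_count count_mon_parts. Qed.

Lemma monom_ofE s i : 0%N \notin s -> monom_of s i = count_mem i.+1 s.
Proof.
move=> s0; have /seq.permP/(_ (pred1 i.+1)) := perm_mon_parts s0.
by rewrite count_mon_parts mul1n.
Qed.

Lemma mon_partsK : cancel mon_parts monom_of.
Proof.
move=> m; apply/eqP/cmP => i.
by rewrite monom_ofE ?mon_parts_neq0 // count_mon_parts mul1n.
Qed.

Lemma psum_part_mon_parts m : psum_part (mon_parts m) = << m >> :> symf K.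
Proof. by rewrite psum_partE -[X in << X >> = _]/(monom_of _) mon_partsK. Qed.
Lemma coefZ c (f : symf K) m : (c *: f)@_m = c * f@_m.
Proof. exact: mcoeffZ. Qed.

Lemma coefD (f g : symf K) m : (f + g)@_m = f@_m + g@_m.
Proof. exact: mcoeffD. Qed.

Lemma malgUZ c (m : {cmonom nat}) : << c *g m >> = c *: << m >> :> symf K.
Proof. by apply/malgP => m'; rewrite mcoeffU coefZ mcoeffU1 mulr_natr. Qed.

(** Induction over the linear span of the monomials. *)
Lemma symf_mon_ind (P : symf K -> Prop) :
    (forall c f g, P f -> P g -> P (c *: f + g)) -> (forall m, P << m >>) ->
  forall f, P f.
Proof.
move=> PD Pm f; have P0 : P 0.
  by have := PD (-1) _ _ (Pm mone) (Pm mone); rewrite scaleN1r addNr.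
rewrite (monalgE f); elim/big_rec: _ => // m g _ Pg.
rewrite malgUZ; exact: (PD _ _ _ (Pm m) Pg).
Qed.

Lemma symf_ind (P : symf K -> Prop) :
    (forall c f g, P f -> P g -> P (c *: f + g)) -> P 1 ->
    (forall k f, P f -> P (psum k.+1 * f)) ->
  forall f, P f.
Proof.
move=> PD P1 PM; apply: symf_mon_ind; first exact: PD.
move=> m; rewrite -psum_part_mon_parts.
have := mon_parts_neq0 m; rewrite /psum_part.
elim: (mon_parts m) => [|[|k] s IH]; first by rewrite big_nil.
  by rewrite inE.
by rewrite inE big_cons => s0; apply/PM/IH.
Qed.

Lemma dpsum_is_linear k : linear (dpsum k : symf K -> symf K).
Proof.
move=> c f g; apply/malgP => m.
rewrite [LHS]mcoeff_dpsum [X in X *+ _]coefD [X in (X + _) *+ _]coefZ.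
rewrite [RHS]coefD [X in _ = X + _]coefZ.
rewrite [X in _ = _ * X + _]mcoeff_dpsum [X in _ = _ + X]mcoeff_dpsum.
by rewrite mulrnDl mulrnAr.
Qed.

HB.instance Definition _ k :=
  GRing.isLinear.Build K (symf K) (symf K) *:%R (dpsum k) (dpsum_is_linear k).

Lemma dpsum1 k : dpsum k 1 = 0 :> symf K.
Proof.
apply/malgP => m; rewrite [LHS]mcoeff_dpsum [RHS]mcoeff0 [X in X *+ _]mcoeff1.
by rewrite cmM_eq1 cm1_eq1 andbF mul0rn.
Qed.

Lemma psumM_mon k m : psum k.+1 * << m >> = << mmul m (ucm k) >> :> symf K.
Proof. by rewrite [LHS]malgUM mulmC. Qed.

Lemma dpsum_mon k m :
  dpsum k.+1 << m >> = (m k)%:R *: << divcm m (ucm k) >> :> symf K.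
Proof.
rewrite /dpsum msuppU1 big_seq_fset1 [X in << X *+ _ *g _ >>]mcoeffUU malgUZ.
by [].
Qed.

(** The linearity step of the induction on monomials for the product rule. *)
Lemma derivation_step (A : comAlgType K) (d : {linear A -> A}) (p : A) b c f g :
    d (p * f) = b *: f + p * d f -> d (p * g) = b *: g + p * d g ->
  d (p * (c *: f + g)) = b *: (c *: f + g) + p * d (c *: f + g).
Proof.
move=> Hf Hg; rewrite linearP [p * _]mulrDr -scalerAr linearP Hf Hg.
rewrite [p * (_ + _)]mulrDr -scalerAr !scalerDr (scalerA c) (mulrC c) -scalerA.
by rewrite addrACA.
Qed.

Lemma adjoint_step (A : comAlgType K) (d : {linear A -> A}) (p : A) b c f h g
    (B : A -> {linear A -> K^o}) : (forall x y, B x y = B y x) ->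
    B (p * f) g = b * B f (d g) -> B (p * h) g = b * B h (d g) ->
  B (p * (c *: f + h)) g = b * B (c *: f + h) (d g).
Proof.
move=> BC; rewrite !(BC _ g) !(BC _ (d g)) mulrDr -scalerAr !linearP => -> ->.
by rewrite mulrDr; congr (_ + _); rewrite /= /GRing.scale /= mulrCA.
Qed.

Lemma dpsum_psumM k j (f : symf K) : dpsum k.+1 (psum j.+1 * f)
  = (k == j)%:R *: f + psum j.+1 * dpsum k.+1 f.
Proof.
elim/symf_mon_ind: f => [c f g Hf Hg|m].
  exact: (@derivation_step _ (dpsum k.+1) _ _ c f g Hf Hg).
have scale_eq (m1 m2 : {cmonom nat}) : ((0 < m k)%N -> m1 = m2) ->
    (m k)%:R *: (<< m1 >> : symf K) = (m k)%:R *: (<< m2 >> : symf K).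
  case: (posnP (m k)) => [-> _|mk -> //].
  by rewrite mulr0n [LHS]scale0r [RHS]scale0r.
rewrite [X in dpsum _ X]psumM_mon [LHS]dpsum_mon.
rewrite [X in _ = _ + _ * X]dpsum_mon -[X in _ = _ + X]scalerAr.
rewrite [X in _ = _ + _ *: X]psumM_mon cmM cmU eq_sym.
case: eqP => [<-|/eqP kj].
  rewrite mulr1n [X in _ = X + _]scale1r addn1 -natr1 scalerDl [X in _ + X = _]scale1r [LHS]addrC.
  have -> : divcm (mmul m (ucm k)) (ucm k) = m.
    by apply/eqP/cmP => i; rewrite divcmE cmM addnK.
  rewrite [X in _ = _ + X](scale_eq _ m) // => mk.
  apply/eqP/cmP => i; rewrite cmM divcmE cmU.
  by case: eqP => [<-|]; rewrite ?subnK ?subn0 ?addn0.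
rewrite mulr0n [X in _ = X + _]scale0r [RHS]add0r addn0.
apply: scale_eq => mk; apply/eqP/cmP => i; rewrite !(cmM, divcmE) !cmU.
have := kj; have := mk; do 2!case: eqP => //=; lia.
Qed.

Lemma z_part_cons k s : z_part (k :: s) = (k * (count_mem k s).+1 * z_part s)%N.
Proof.
rewrite /z_part /=; case: ifP => ks; last first.
  rewrite big_cons /= eqxx; rewrite (count_memPn (negbT ks)).
  rewrite addn0 expn1 muln1; congr (_ * _)%N.
  rewrite big_seq [RHS]big_seq; apply: eq_bigr => i.
  by rewrite mem_undup; case: eqP => [<-|]; rewrite ?ks.
have ku : k \in undup s by rewrite mem_undup.
rewrite (bigD1_seq k) ?undup_uniq //= [in RHS](bigD1_seq k) ?undup_uniq //=.
rewrite eqxx add1n expnS factS.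
rewrite (eq_bigr (fun i => i ^ count_mem i s * (count_mem i s)`!)%N); last first.
  by move=> i ik; rewrite eq_sym (negPf ik).
ring.
Qed.

(** The value of the form at a pair of equal monomials. *)
Definition mweight (m : {cmonom nat}) : K :=
  alpha ^+ size (mon_parts m) * (z_part (mon_parts m))%:R.

Lemma perm_mon_partsM m k : perm_eq (mon_parts (mmul m (ucm k))) (k.+1 :: mon_parts m).
Proof.
apply/allP => j _; apply/eqP; rewrite /= !count_mon_parts cmM cmU.
by case: j => [|j] //; rewrite !mul1n eqSS addnC.
Qed.

Lemma mweightM m k :
  mweight (mmul m (ucm k)) = alpha * k.+1%:R * (m k).+1%:R * mweight m.
Proof.
rewrite /mweight (perm_size (perm_mon_partsM m k)) (perm_z_part (perm_mon_partsM m k)).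
rewrite z_part_cons count_mon_parts mul1n [size _]/= exprS.
rewrite !natrM.
move: (z_part _)%:R (alpha ^+ _) (m k).+1%:R (k.+1%:R) => a b c d.
by rewrite -!mulrA; congr (_ * _); rewrite mulrCA; congr (_ * _); rewrite mulrCA.
Qed.

Lemma jack_scalar_monl m (f : symf K) :
  jack_scalar alpha << m >> f = mweight m * f@_m.
Proof.
rewrite /jack_scalar msuppU1 big_seq_fset1 [X in _ * X * _]mcoeffUU mulr1.
by [].
Qed.

Lemma jack_scalarEw (d : {fset {cmonom nat}}) (f g : symf K) : (msupp f `<=` d)%fset ->
  jack_scalar alpha f g = \sum_(m <- d) mweight m * f@_m * g@_m.
Proof.
move=> fd; rewrite /jack_scalar (big_fset_incl _ fd) //= => m _ mf.
by rewrite [X in _ * X * _]mcoeff_outdom // mulr0 mul0r.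
Qed.

Lemma jack_scalarC (f g : symf K) : jack_scalar alpha f g = jack_scalar alpha g f.
Proof.
rewrite (jack_scalarEw _ (fsubsetUl (msupp f) (msupp g))).
rewrite (jack_scalarEw _ (fsubsetUr (msupp f) (msupp g))).
by apply: eq_bigr => m _; rewrite mulrAC.
Qed.

Lemma jack_scalar_linear (f : symf K) : linear (jack_scalar alpha f : symf K -> K^o).
Proof.
move=> c g h; rewrite /jack_scalar scaler_sumr -big_split /=.
apply: eq_bigr => m _; rewrite [X in _ * X]coefD [X in _ * (X + _)]coefZ.
by rewrite mulrDr; congr (_ + _); rewrite mulrCA.
Qed.

HB.instance Definition _ f :=
  GRing.isLinear.Build K (symf K) K^o *:%R (jack_scalar alpha f) (jack_scalar_linear f).

Lemma jack_scalar_psumM k (f g : symf K) : jack_scalar alpha (psum k.+1 * f) g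
  = alpha * k.+1%:R * jack_scalar alpha f (dpsum k.+1 g).
Proof.
elim/symf_mon_ind: f => [c f h Hf Hh|m].
  exact: (adjoint_step c jack_scalarC Hf Hh).
rewrite [X in jack_scalar _ X _ = _]psumM_mon [LHS]jack_scalar_monl.
rewrite [X in _ = _ * X]jack_scalar_monl mweightM.
rewrite [X in _ = _ * (_ * X)]mcoeff_dpsum -[X in _ = _ * (_ * X)]mulr_natr.
move: (alpha * _) (m k).+1%:R (mweight m) (g@__) => a b c d.
by rewrite -!mulrA; congr (_ * _); rewrite !mulrA [RHS]mulrC mulrA.
Qed.

Lemma jack_scalar11 : jack_scalar alpha 1 1 = 1.
Proof.
rewrite [LHS]jack_scalar_monl [X in _ * X]mcoeffUU /mweight.
have -> : mon_parts (mone : {cmonom nat}) = [::].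
  by have := @perm_mon_parts [::] isT; rewrite big_nil => /perm_nilP.
by rewrite /z_part big_nil expr0 !mulr1.
Qed.

End PowerSums.

(** * The Laplace-Beltrami operator *)

(** In this section p k and d k stand for the k-th power sum and the partial
    derivative in it, k > 0, and B is the form for which alpha k (d k) is the
    adjoint of the multiplication by p k.  The induction principle says that
    the p k generate A. *)

Section FockSpace.
Variables (K : fieldType) (alpha : K).
Hypothesis char0 : forall n, n.+1%:R != 0 :> K.
Hypothesis alpha_neq0 : alpha != 0.

Variable A : comAlgType K.
Variable p : nat -> A.
Variable d : nat -> {linear A -> A}.
Variable B : A -> {linear A -> K^o}.
Variable D : A -> A.
Hypothesis A_ind : forall P : A -> Prop,
    (forall c f h, P f -> P h -> P (c *: f + h)) -> P 1 ->
    (forall k f, P f -> P (p k.+1 * f)) ->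
  forall f, P f.
Hypothesis d_1 : forall k, d k.+1 1 = 0.
Hypothesis d_pM : forall k j f,
  d k.+1 (p j.+1 * f) = (k == j)%:R *: f + p j.+1 * d k.+1 f.
Hypothesis BC : forall f h, B f h = B h f.
Hypothesis B_pM : forall k f h, B (p k.+1 * f) h = alpha * k.+1%:R * B f (d k.+1 h).
Hypothesis B_11 : B 1 1 = 1.
Hypothesis B_anisotropic : forall f, B f f = 0 -> f = 0.
Definition D_upto (N : nat) (f : A) : A :=
  ((alpha - 1) / 2) *: (\sum_(1 <= i < N.+1) (p i * d i f) *+ (i * (i - 1)))
  + (alpha / 2) *: (\sum_(1 <= i < N.+1) \sum_(1 <= j < N.+1)
                      (p (i + j) * d i (d j f)) *+ (i * j))
  + 2^-1 *: (\sum_(1 <= i < N.+1) \sum_(1 <= j < N.+1)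
               (p i * p j * d (i + j) f) *+ (i + j)).
Hypothesis D_uptoE : forall f, exists N0, forall N, (N0 <= N)%N -> D f = D_upto N f.

Lemma scale_natK n (f : A) : f *+ n = n%:R *: f.
Proof. by rewrite scaler_nat. Qed.

Lemma d_M k f h : d k.+1 (f * h) = d k.+1 f * h + f * d k.+1 h.
Proof.
elim/A_ind: f => [c f f' Hf Hf'||j f Hf].
- rewrite mulrDl -scalerAl !linearP Hf Hf' !mulrDl !scalerDr -!scalerAl.
  by rewrite addrACA.
- by rewrite d_1 mul0r add0r !mul1r.
- by rewrite -mulrA !d_pM Hf mulrDr mulrDl -scalerAl !mulrA !addrA.
Qed.

Lemma B_Mp k f h : B f (p k.+1 * h) = alpha * k.+1%:R * B (d k.+1 f) h.
Proof. by rewrite BC B_pM BC. Qed.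

Lemma d_p k j : d k.+1 (p j.+1) = (k == j)%:R%:A.
Proof. by rewrite -[p _]mulr1 d_pM d_1 mulr0 addr0. Qed.

(** The three parts of the Laplace-Beltrami operator: of order one, joining two
    parts, and cutting a part in two. *)
Definition scaling_part N f : A := \sum_(i < N) (i.+1 * i)%:R *: (p i.+1 * d i.+1 f).
Definition join_part N f : A := \sum_(i < N) \sum_(j < N)
   (i.+1 * j.+1)%:R *: (p (i.+1 + j.+1) * d i.+1 (d j.+1 f)).
Definition cut_part N f : A := \sum_(i < N) \sum_(j < N)
   (i.+1 + j.+1)%:R *: (p i.+1 * p j.+1 * d (i.+1 + j.+1) f).
(** The symmetric bidifferential operator whose diagonal is the second-order
    symbol of [join_part]. *)
Definition join_polar N f h : A := \sum_(i < N) \sum_(j < N)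
   (i.+1 * j.+1)%:R *: (p (i.+1 + j.+1) * (d i.+1 f * d j.+1 h)).

Lemma D_upto_parts N f : D_upto N f
  = ((alpha - 1) / 2) *: scaling_part N f + (alpha / 2) *: join_part N f + 2^-1 *: cut_part N f.
Proof.
rewrite /D_upto /scaling_part /join_part /cut_part !big_add1 !big_mkord.
congr (_ *: _ + _ *: _ + _ *: _); apply: eq_bigr => i _.
- by rewrite scale_natK subn1.
- by rewrite big_add1 big_mkord; apply: eq_bigr => j _; rewrite scale_natK.
- by rewrite big_add1 big_mkord; apply: eq_bigr => j _; rewrite scale_natK.
Qed.

Lemma scaling_part_linear N : linear (scaling_part N).
Proof.
move=> c f h; rewrite /scaling_part scaler_sumr -big_split; apply: eq_bigr => i _ /=.
by rewrite linearP mulrDr -scalerAr scalerDr !scalerA mulrC.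
Qed.

Lemma join_part_linear N : linear (join_part N).
Proof.
move=> c f h; rewrite /join_part scaler_sumr -big_split; apply: eq_bigr => i _ /=.
rewrite scaler_sumr -big_split; apply: eq_bigr => j _ /=.
by rewrite !linearP mulrDr -scalerAr scalerDr !scalerA mulrC.
Qed.

Lemma cut_part_linear N : linear (cut_part N).
Proof.
move=> c f h; rewrite /cut_part scaler_sumr -big_split; apply: eq_bigr => i _ /=.
rewrite scaler_sumr -big_split; apply: eq_bigr => j _ /=.
by rewrite linearP mulrDr -scalerAr scalerDr !scalerA mulrC.
Qed.

Lemma D_upto_linear N : linear (D_upto N).
Proof.
move=> c f h; rewrite !D_upto_parts scaling_part_linear join_part_linear cut_part_linear !scalerDr !scalerA.
by rewrite !(mulrC c); ring.
Qed.

Lemma scaling_part_M N f h : scaling_part N (f * h) = scaling_part N f * h + f * scaling_part N h.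
Proof.
rewrite /scaling_part mulr_suml mulr_sumr -big_split; apply: eq_bigr => i _ /=.
by rewrite d_M mulrDr scalerDr -scalerAl -scalerAr mulrA mulrCA.
Qed.

Lemma cut_part_M N f h : cut_part N (f * h) = cut_part N f * h + f * cut_part N h.
Proof.
rewrite /cut_part mulr_suml mulr_sumr -big_split; apply: eq_bigr => i _ /=.
rewrite mulr_suml mulr_sumr -big_split; apply: eq_bigr => j _ /=.
by rewrite d_M mulrDr scalerDr -scalerAl -scalerAr mulrA [in X in _ + X]mulrCA.
Qed.

Lemma join_polarC N f h : join_polar N f h = join_polar N h f.
Proof.
rewrite /join_polar exchange_big; apply: eq_bigr => i _; apply: eq_bigr => j _ /=.
by rewrite mulnC addnC [X in _ * X]mulrC.
Qed.

Lemma join_part_M N f h :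
  join_part N (f * h) = join_part N f * h + f * join_part N h + 2 *: join_polar N f h.
Proof.
rewrite scaler_nat mulr2n [X in _ + (X + _)]join_polarC.
rewrite /join_part /join_polar mulr_suml mulr_sumr -!big_split; apply: eq_bigr => i _ /=.
rewrite mulr_suml mulr_sumr -!big_split; apply: eq_bigr => j _ /=.
rewrite !d_M linearD /= !d_M -!scalerAl -!scalerAr -!scalerDr; congr (_ *: _).
ring.
Qed.

Lemma two_neq0 : 2 != 0 :> K. Proof. exact: char0 1%N. Qed.

Lemma D_upto_M N f h : D_upto N (f * h)
  = D_upto N f * h + f * D_upto N h + alpha *: join_polar N f h.
Proof.
rewrite !D_upto_parts scaling_part_M join_part_M cut_part_M !scalerDr !mulrDl !mulrDr !scalerA.
rewrite divfK ?two_neq0 // -!scalerAl -!scalerAr.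
ring.
Qed.

Lemma natK_neq0 n : (0 < n)%N -> n%:R != 0 :> K.
Proof. by case: n => // n _; apply: char0. Qed.

Lemma B_d k f h : B (d k.+1 f) h = (alpha * k.+1%:R)^-1 * B f (p k.+1 * h).
Proof.
by rewrite B_Mp mulKf // mulf_neq0 ?alpha_neq0 ?char0.
Qed.

(** Joining i and j is adjoint to cutting i + j; the factor alpha^-1 is the
    defect in the number of parts, and it balances the coefficients alpha/2 and
    1/2 in D. *)
Lemma join_cut_adj N f h : B (join_part N f) h = alpha^-1 * B f (cut_part N h).
Proof.
rewrite BC !linear_sum mulr_sumr; apply: eq_bigr => i _.
rewrite !linear_sum mulr_sumr; apply: eq_bigr => j _.
rewrite !linearZ /= /GRing.scale /= BC -[(i.+1 + j.+1)%N]/((i + j.+1).+1).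
rewrite B_pM !B_d mulrA mulrA mulrCA !mulrA [p j.+1 * _]mulrC natrM.
move: (char0 i) (char0 j) alpha_neq0 => x0 y0 z0.
move: (i.+1%:R : K) (j.+1%:R : K) x0 y0 => x y x0 y0.
by field; rewrite z0 x0 y0.
Qed.

Lemma scaling_part_adj N f h : B (scaling_part N f) h = B f (scaling_part N h).
Proof.
rewrite BC !linear_sum; apply: eq_bigr => i _.
by rewrite !linearZ /= BC B_pM B_Mp.
Qed.

Lemma D_upto_adj N f h : B (D_upto N f) h = B f (D_upto N h).
Proof.
rewrite BC !D_upto_parts !linearD !linearZ /= !(BC h) /GRing.scale /=.
rewrite scaling_part_adj join_cut_adj [B (cut_part N f) h]BC.
have -> : B f (join_part N h) = alpha^-1 * B h (cut_part N f) by rewrite BC join_cut_adj.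
by field; rewrite two_neq0 alpha_neq0.
Qed.

(** The truncation may be chosen uniformly for finitely many functions. *)
Lemma D_stable (s : seq A) :
  exists N0, forall N, (N0 <= N)%N -> {in s, D =1 D_upto N}.
Proof.
elim: s => [|f s [N0 IH]]; first by exists 0%N.
have [N1 Hf] := D_uptoE f; exists (maxn N0 N1) => N.
rewrite geq_max => /andP[le0 le1] h; rewrite inE => /predU1P[->|hs].
  exact: Hf.
exact: IH.
Qed.

Lemma D_is_linear : linear D.
Proof.
move=> c f h; have [N HN] := D_stable [:: f; h; c *: f + h].
by rewrite !(HN N) ?inE ?eqxx ?orbT // D_upto_linear.
Qed.

HB.instance Definition _ := GRing.isLinear.Build K A A *:%R D D_is_linear.

Lemma D_adj f h : B (D f) h = B f (D h).
Proof.
have [N HN] := D_stable [:: f; h].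
by rewrite !(HN N) ?inE ?eqxx ?orbT // D_upto_adj.
Qed.

(** The failure of D to be a derivation.  As D has order two, this is the
    bidifferential operator [join_polar], a derivation in each argument. *)
Definition polar (f h : A) : A := D (f * h) - D f * h - f * D h.

Lemma D_M f h : D (f * h) = D f * h + f * D h + polar f h.
Proof. by rewrite /polar; ring. Qed.

Lemma polarE (s : seq A) : exists N0, forall N, (N0 <= N)%N ->
  forall f h, f \in s -> h \in s -> polar f h = alpha *: join_polar N f h.
Proof.
have [N0 HN] := D_stable (s ++ [seq f * h | f <- s, h <- s]).
exists N0 => N le f h fs hs; rewrite /polar !(HN N) ?mem_cat ?fs ?hs //.
  by rewrite D_upto_M; ring.
by rewrite allpairs_f ?orbT.
Qed.

Lemma polarC f h : polar f h = polar h f.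
Proof. by rewrite /polar mulrC; ring. Qed.

Lemma polar_is_linear f : linear (polar f).
Proof.
move=> c h h'; rewrite /polar mulrDr -scalerAr !linearP /= mulrDr -scalerAr mulrDr.
rewrite -scalerAr !scalerDr !scalerN; ring.
Qed.

HB.instance Definition _ f :=
  GRing.isLinear.Build K A A *:%R (polar f) (polar_is_linear f).

Lemma polar_M f h k : polar f (h * k) = polar f h * k + h * polar f k.
Proof.
have [N HN] := polarE [:: f; h; k; h * k].
rewrite !(HN N) ?inE ?eqxx ?orbT // -scalerAl -scalerAr -scalerDr; congr (_ *: _).
rewrite /join_polar mulr_suml mulr_sumr -big_split; apply: eq_bigr => i _ /=.
rewrite mulr_suml mulr_sumr -big_split; apply: eq_bigr => j _ /=.
by rewrite d_M -scalerAl -scalerAr -scalerDr; congr (_ *: _); ring.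
Qed.

Lemma polar_pp i j : polar (p i.+1) (p j.+1)
  = (alpha * (i.+1 * j.+1)%:R) *: p (i.+1 + j.+1).
Proof.
have [N0 HN] := polarE [:: p i.+1; p j.+1].
pose N := (maxn N0 (maxn i.+1 j.+1)).
have [leN0 leNi leNj] : [/\ (N0 <= N)%N, (i < N)%N & (j < N)%N].
  by split; rewrite /N !leq_max ?leqnn ?orbT.
rewrite (HN N) ?inE ?eqxx ?orbT // -scalerA; congr (_ *: _).
rewrite /join_polar (bigD1 (Ordinal leNi)) //= (bigD1 (Ordinal leNj)) //=.
rewrite big1 => [|k /eqP ne]; last first.
  rewrite [d k.+1 _]d_p; case: eqP => [e|_]; first by case: ne; apply: val_inj.
  by rewrite mulr0n scale0r !mulr0 scaler0.
rewrite big1 => [|k /eqP ne]; last first.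
  apply: big1 => l _; rewrite [d k.+1 _]d_p; case: eqP => [e|_].
    by case: ne; apply: val_inj.
  by rewrite mulr0n scale0r mul0r mulr0 scaler0.
by rewrite !d_p !eqxx !scale1r !mulr1 !addr0.
Qed.

Lemma D_p1 : D (p 1) = 0.
Proof.
have [N HN] := D_uptoE (p 1); rewrite (HN N) // D_upto_parts.
rewrite [scaling_part _ _]big1 => [|[[|i] ltiN] _]; first last.
- by rewrite d_p mulr0n scale0r mulr0 scaler0.
- by rewrite muln0 scale0r.
rewrite [join_part _ _]big1 => [|i _]; last first.
  by apply: big1 => j _; rewrite d_p linearZ /= d_1 scaler0 mulr0 scaler0.
rewrite [cut_part _ _]big1 => [|i _]; last first.
  apply: big1 => j _; rewrite -[(i.+1 + j.+1)%N]/((i + j.+1).+1).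
  by rewrite d_p addnS mulr0n scale0r mulr0 scaler0.
by rewrite !scaler0 !addr0.
Qed.

(** * The functions dual to the monomial functions *)

(** The values g_0, ..., g_n, from Newton's identity
    alpha n g_n = sum_(0 < k <= n) p_k g_(n-k). *)
Fixpoint jackg_table (n : nat) : seq A :=
  if n is m.+1 then
    let t := jackg_table m in
    rcons t ((alpha * m.+1%:R)^-1 *: \sum_(k < m.+1) p k.+1 * nth 0 t (m - k))
  else [:: 1].

Definition jackg (n : nat) : A := nth 0 (jackg_table n) n.

Lemma size_jackg_table n : size (jackg_table n) = n.+1.
Proof. by elim: n => //= n IH; rewrite size_rcons IH. Qed.

Lemma nth_jackg_table m n : (m <= n)%N -> nth 0 (jackg_table n) m = jackg m.
Proof.
elim: n => [|n IH]; first by rewrite leqn0 => /eqP ->.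
rewrite leq_eqVlt => /predU1P[-> //|]; rewrite ltnS => le_mn.
by rewrite /= nth_rcons size_jackg_table ltnS le_mn IH.
Qed.

Lemma jackg0 : jackg 0 = 1. Proof. by []. Qed.

Lemma jackgS n : (alpha * n.+1%:R) *: jackg n.+1 = \sum_(k < n.+1) p k.+1 * jackg (n - k).
Proof.
rewrite {1}/jackg /= nth_rcons size_jackg_table ltnn eqxx scalerA mulfV; last first.
  by rewrite mulf_neq0 ?alpha_neq0 ?char0.
rewrite scale1r; apply: eq_bigr => k _; rewrite nth_jackg_table //; exact: leq_subr.
Qed.

(** The coefficient of t^n in t^i G(t), where G(t) is the generating series of
    the g_n; with it the sums over power sums have no upper limit that depends
    on n. *)
Definition jackg_shift (n i : nat) : A := if (i <= n)%N then jackg (n - i) else 0.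

Lemma jackg_shiftS n i : jackg_shift n.+1 i.+1 = jackg_shift n i.
Proof. by rewrite /jackg_shift ltnS subSS. Qed.

Lemma jackg_shift0 n : jackg_shift n 0 = jackg n.
Proof. by rewrite /jackg_shift subn0. Qed.

Lemma jackg_shift_rec N n i : (n <= N)%N -> (alpha * (n - i)%:R) *: jackg_shift n i
  = \sum_(k < N) p k.+1 * jackg_shift n (i + k.+1).
Proof.
move=> nN; case: (leqP i n) => [lein|ltni]; last first.
  rewrite /jackg_shift leqNgt ltni scaler0 big1 // => k _.
  by rewrite leqNgt (leq_trans ltni) ?leq_addr // mulr0.
rewrite {1}/jackg_shift lein; case def_m: (n - i)%N => [|m].
  rewrite mulr0 scale0r big1 // => k _; rewrite /jackg_shift.
  by rewrite leqNgt -[n](subnK lein) def_m addnS ltnS leq_addr mulr0.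
rewrite jackgS; have le_mN : (m.+1 <= N)%N by rewrite -def_m (leq_trans (leq_subr _ _)).
rewrite (big_ord_widen N (fun k => p k.+1 * jackg (m - k)) le_mN) big_mkcond /=.
apply: eq_bigr => k _; rewrite /jackg_shift -leq_subRL // def_m subnDA def_m.
by rewrite ltnS subSS; case: ifP => // _; rewrite mulr0.
Qed.

(** The derivative of G(t) in p_k is t^k / (alpha k) G(t). *)
Lemma d_jackg k n : d k.+1 (jackg n) = (alpha * k.+1%:R)^-1 *: jackg_shift n k.+1.
Proof.
elim/ltn_ind: n => -[|n] IH; first by rewrite jackg0 d_1 /jackg_shift scaler0.
have ak : alpha * k.+1%:R != 0 by rewrite mulf_neq0 ?alpha_neq0 ?char0.
have an : alpha * n.+1%:R != 0 by rewrite mulf_neq0 ?alpha_neq0 ?char0.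
apply: (scalerI an); rewrite -linearZ jackgS linear_sum /=.
transitivity (\sum_(j < n.+1) ((k == j)%:R *: jackg_shift n.+1 j.+1
    + (alpha * k.+1%:R)^-1 *: (p j.+1 * jackg_shift n.+1 (k.+1 + j.+1)))).
  apply: eq_bigr => j _; have jn : (j <= n)%N by rewrite -ltnS.
  rewrite d_pM jackg_shiftS {1}/jackg_shift jn; congr (_ + _).
  rewrite IH ?ltnS ?leq_subr // -scalerAr; congr (_ *: (_ * _)).
  rewrite /jackg_shift addnS ltnS addSn -[in RHS]addnS; congr (if _ then _ else _).
    by lia.
  by congr jackg; lia.
rewrite big_split /= -scaler_sumr -jackg_shift_rec // subSS.
have -> : \sum_(j < n.+1) (k == j)%:R *: jackg_shift n.+1 j.+1 = jackg_shift n.+1 k.+1.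
  case: (ltnP k n.+1) => [lt_kn|le_nk].
    rewrite (bigD1 (Ordinal lt_kn)) //= eqxx scale1r big1 ?addr0 // => j /eqP ne.
    case: eqP => [e|_]; first by case: ne; apply: val_inj.
    by rewrite scale0r.
  rewrite /jackg_shift ltnS leqNgt le_nk big1 // => j _; case: eqP => [e|_].
    by move: (ltn_ord j); rewrite -e ltnNge le_nk.
  by rewrite scale0r.
rewrite !scalerA -[X in X + _]scale1r -scalerDl.
case: (leqP k n) => [le_kn|lt_nk]; last by rewrite /jackg_shift ltnS leqNgt lt_nk !scaler0.
congr (_ *: _); rewrite natrB // -!natr1.
move: ak; rewrite -natr1 => ak.
by field; move: ak; rewrite mulf_eq0 negb_or => /andP[-> ->].
Qed.

Lemma d_jackg_shift k n i : d k.+1 (jackg_shift n i) = (alpha * k.+1%:R)^-1 *: jackg_shift n (i + k.+1).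
Proof.
rewrite /jackg_shift; case: leqP => [le_in|lt_ni]; last first.
  by rewrite linear0 leqNgt (leq_trans lt_ni) ?leq_addr // scaler0.
by rewrite d_jackg /jackg_shift leq_subRL // subnDA.
Qed.

Lemma sum_antidiag N (F : nat -> A) : (forall k, (N < k)%N -> F k = 0) ->
  \sum_(i < N) \sum_(j < N) F (i.+1 + j.+1)%N = \sum_(k < N) k%:R *: F k.+1.
Proof.
move=> F0; have row i : (i < N)%N ->
    \sum_(j < N) F (i.+1 + j.+1)%N = \sum_(k < N | (i < k)%N) F k.+1.
  move=> lt_iN; transitivity (\sum_(i.+1 <= k < N) F k.+1); last first.
    by rewrite big_geq_mkord; apply: eq_bigl => k.
  rewrite -(big_mkord xpredT (fun j => F (i.+1 + j.+1)%N)).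
  rewrite [LHS](@big_cat_nat _ _ _ (N - i.+1)%N) ?leq_subr //=.
  rewrite [X in _ + X]big_nat [X in _ + X]big1 ?addr0; last first.
    by move=> j /andP[le_j _]; apply: F0; lia.
  rewrite -[in RHS](add0n i.+1) big_addn; apply: eq_bigr => j _; congr F; lia.
rewrite (eq_bigr _ (fun (i : 'I_N) _ => row i (ltn_ord i))).
rewrite (exchange_big_dep xpredT) //=; apply: eq_bigr => k _.
rewrite -(big_ord_widen N (fun=> F k.+1)) 1?ltnW //.
by rewrite sumr_const card_ord scaler_nat.
Qed.

Lemma D_1 : D 1 = 0.
Proof.
have : polar 1 1 = 0.
  have [N HN] := polarE [:: 1]; rewrite (HN N) ?inE // /join_polar.
  rewrite big1 ?scaler0 // => i _; rewrite big1 // => j _.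
  by rewrite d_1 mul0r mulr0 scaler0.
by rewrite /polar !mul1r mulr1 subrr sub0r => /eqP; rewrite oppr_eq0 => /eqP.
Qed.

Lemma jackg_shift_gt n k : (n < k)%N -> jackg_shift n k = 0.
Proof. by move=> lt_nk; rewrite /jackg_shift leqNgt lt_nk. Qed.

Lemma jackg_rec N n : (n <= N)%N ->
  (alpha * n%:R) *: jackg n = \sum_(k < N) p k.+1 * jackg_shift n k.+1.
Proof. by move=> /(jackg_shift_rec 0); rewrite subn0 jackg_shift0. Qed.

(** Every part of D turns G(t) into a multiple of itself by power sums; with
    U = sum_k (k-1) p_k g_(n-k) and V = alpha n g_n, the three parts are U/alpha,
    U/alpha^2 and (n-1) V - U, and U cancels. *)
Lemma D_jackg n : D (jackg n) = (alpha * 'C(n, 2)%:R) *: jackg n.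
Proof.
have [N0 HN] := D_uptoE (jackg n); pose N := maxn N0 n.
have leN : (N0 <= N)%N by rewrite leq_maxl.
have leNn : (n <= N)%N by rewrite leq_maxr.
rewrite (HN N leN) D_upto_parts.
pose U := \sum_(k < N) k%:R *: (p k.+1 * jackg_shift n k.+1).
pose V := \sum_(k < N) p k.+1 * jackg_shift n k.+1.
have VE : V = (alpha * n%:R) *: jackg n by rewrite (jackg_rec leNn).
have -> : scaling_part N (jackg n) = alpha^-1 *: U.
  rewrite scaler_sumr; apply: eq_bigr => i _.
  rewrite d_jackg -scalerAr !scalerA natrM; congr (_ *: _).
  move: (char0 i) alpha_neq0; move: (i.+1%:R : K) => x x0 a0.
  by field; rewrite x0 a0.
have -> : join_part N (jackg n) = alpha^-2 *: U.
  have <- : \sum_(i < N) \sum_(j < N) p (i.+1 + j.+1) * jackg_shift n (i.+1 + j.+1) = U.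
    apply: (@sum_antidiag N (fun k => p k * jackg_shift n k)) => k ltk.
    by rewrite jackg_shift_gt ?mulr0 // (leq_ltn_trans leNn).
  rewrite scaler_sumr; apply: eq_bigr => i _.
  rewrite scaler_sumr; apply: eq_bigr => j _.
  rewrite d_jackg linearZ /= d_jackg_shift -!scalerAr !scalerA natrM addnC; congr (_ *: _).
  move: (char0 i) (char0 j) alpha_neq0.
  move: (i.+1%:R : K) (j.+1%:R : K) => x y x0 y0 a0.
  by field; rewrite x0 y0 a0.
have -> : cut_part N (jackg n) = (n%:R - 1) *: V - U.
  transitivity (alpha^-1 *: \sum_(i < N) p i.+1 * ((alpha * (n - i.+1)%:R) *: jackg_shift n i.+1)).
    rewrite scaler_sumr; apply: eq_bigr => i _; rewrite (jackg_shift_rec _ leNn).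
    rewrite mulr_sumr scaler_sumr; apply: eq_bigr => j _.
    rewrite -[(i.+1 + j.+1)%N]/((i + j.+1).+1) d_jackg -!scalerAr scalerA mulrA.
    congr (_ *: _); move: (char0 (i + j.+1)) alpha_neq0.
    by move: ((i + j.+1).+1%:R : K) => x x0 a0; field; rewrite x0 a0.
  rewrite !scaler_sumr -sumrB; apply: eq_bigr => i _.
  rewrite -!scalerAr scalerA mulKf ?alpha_neq0 // -scalerBl.
  case: (leqP i.+1 n) => [le_in|lt_ni]; last by rewrite jackg_shift_gt ?mulr0 ?scaler0.
  by rewrite natrB // -natr1; congr (_ *: _); ring.
have -> : ('C(n, 2)%:R : K) = n%:R * (n%:R - 1) / 2.
  case: (n) => [|m]; first by rewrite !mul0r.
  rewrite -[m.+1%:R - 1]/(m.+1%:R - 1%:R) -natrB // subn1 /= -natrM.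
  apply: (mulIf two_neq0); rewrite divfK ?two_neq0 // -natrM; congr _%:R.
  by rewrite bin2 mulnC mul2n -{1}[RHS]odd_double_half oddM /= andNb.
rewrite VE scalerBr !scalerA.
transitivity (((alpha - 1) / 2 / alpha + alpha / 2 * alpha^-2 - 2^-1) *: U
              + (2^-1 * (n%:R - 1) * (alpha * n%:R)) *: jackg n).
  by rewrite -!mulrA scalerBl scalerDl; ring.
have -> : (alpha - 1) / 2 / alpha + alpha / 2 * alpha^-2 - 2^-1 = 0.
  by field; rewrite two_neq0 alpha_neq0.
by rewrite scale0r add0r; congr (_ *: _); field; rewrite two_neq0.
Qed.

(** In generating series, [polar] (G(t)) (G(s)) is
    t s / (t - s) (G'(t) G(s) - G(t) G'(s)); this is the identity obtained by
    clearing the denominator.  Iterated, it expands [polar] (g_m) (g_n) in the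
    products g_(m+r) g_(n-r), whichever of m and n is larger. *)
Lemma polar_jackg_rec m n : polar (jackg m) (jackg n.+1)
  = polar (jackg m.+1) (jackg n) + m.+1%:R *: (jackg m.+1 * jackg n) - n.+1%:R *: (jackg m * jackg n.+1).
Proof.
pose s := [:: m; n.+1; m.+1; n]; have [N0 HN] := polarE (map jackg s).
pose N := maxn N0 (maxn m.+2 n.+2).
have [leN0 lem len] : [/\ (N0 <= N)%N, (m.+1 < N)%N & (n.+1 < N)%N].
  by split; rewrite /N !leq_max ?leqnn ?orbT.
have gamgg a b : a \in s -> b \in s ->
    polar (jackg a) (jackg b) = alpha^-1 *: \sum_(i < N) \sum_(j < N)
       p (i.+1 + j.+1) * (jackg_shift a i.+1 * jackg_shift b j.+1).
  move=> sa sb; rewrite (HN N leN0 _ _ (map_f jackg sa) (map_f jackg sb)).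
  rewrite /join_polar !scaler_sumr; apply: eq_bigr => i _.
  rewrite !scaler_sumr; apply: eq_bigr => j _.
  rewrite !d_jackg -!scalerAr -!scalerAl -!scalerAr !scalerA natrM; congr (_ *: _).
  move: (char0 i) (char0 j) alpha_neq0.
  move: (i.+1%:R : K) (j.+1%:R : K) => x y x0 y0 a0.
  by field; rewrite x0 y0 a0.
rewrite !gamgg ?inE ?eqxx ?orbT //.
(* Both double sums are sums of F over a square; they differ by one column
   and one row. *)
pose F i j := p (i + j).+1 * (jackg_shift m i * jackg_shift n j).
have -> : \sum_(i < N) \sum_(j < N) p (i.+1 + j.+1) * (jackg_shift m i.+1 * jackg_shift n.+1 j.+1)
    = \sum_(i < N) \sum_(j < N) F i.+1 j.+1 + \sum_(i < N) F i.+1 0%N.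
  rewrite -big_split; apply: eq_bigr => i _ /=; rewrite addrC.
  rewrite -(big_ord_recl N (fun j => F i.+1 j)) big_ord_recr /=.
  rewrite {2}/F [jackg_shift n N]jackg_shift_gt ?mulr0 ?addr0; last by lia.
  by apply: eq_bigr => j _; rewrite jackg_shiftS /F addnS.
have -> : \sum_(i < N) \sum_(j < N) p (i.+1 + j.+1) * (jackg_shift m.+1 i.+1 * jackg_shift n j.+1)
    = \sum_(i < N) \sum_(j < N) F i.+1 j.+1 + \sum_(j < N) F 0%N j.+1.
  rewrite exchange_big [X in _ = X + _]exchange_big -big_split.
  apply: eq_bigr => j _ /=; rewrite addrC.
  rewrite -(big_ord_recl N (fun i => F i j.+1)) big_ord_recr /=.
  rewrite {2}/F [jackg_shift m N]jackg_shift_gt ?mul0r ?mulr0 ?addr0; last by lia.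
  by apply: eq_bigr => i _; rewrite jackg_shiftS /F addSn.
have E1 : alpha *: (m.+1%:R *: (jackg m.+1 * jackg n))
    = p 1 * (jackg m * jackg n) + \sum_(i < N) F i.+1 0%N.
  rewrite scalerA scalerAl.
  rewrite (@jackg_rec N.+1); last by lia.
  rewrite mulr_suml big_ord_recl /= jackg_shiftS jackg_shift0 mulrA.
  congr (_ + _); apply: eq_bigr => i _.
  by rewrite /F jackg_shiftS jackg_shift0 addn0 mulrA.
have E2 : alpha *: (n.+1%:R *: (jackg m * jackg n.+1))
    = p 1 * (jackg m * jackg n) + \sum_(j < N) F 0%N j.+1.
  rewrite scalerA scalerAr.
  rewrite (@jackg_rec N.+1); last by lia.
  rewrite mulr_sumr big_ord_recl /= jackg_shiftS jackg_shift0 mulrCA.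
  congr (_ + _); apply: eq_bigr => i _.
  by rewrite /F jackg_shiftS jackg_shift0 add0n mulrCA.
apply: (scalerI alpha_neq0); rewrite !scalerDr scalerN E1 E2 !scalerA.
by rewrite mulfV ?alpha_neq0 // !scale1r; ring.
Qed.

Lemma polar_jackg0 m : polar (jackg m) (jackg 0) = 0.
Proof. by rewrite /polar jackg0 !mulr1 D_1 mulr0 subrr subr0. Qed.

Definition jackg_prod (s : seq nat) : A := \prod_(k <- s) jackg k.

Lemma jackg_prod_cons k s : jackg_prod (k :: s) = jackg k * jackg_prod s.
Proof. by rewrite /jackg_prod big_cons. Qed.

(** The functional L with a factor put into its argument: inductions over
    products move one factor at a time into it. *)
Definition linmul (L : {linear A -> K^o}) (x : A) : {linear A -> K^o} :=
  L \o (x \*o idfun).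

Lemma linmulE L x f : linmul L x f = L (x * f).
Proof. by []. Qed.

(** Only the term r = 0 of the raising expansion survives. *)
Lemma lin_polar_jackg (L : {linear A -> K^o}) m n :
    (forall r, (0 < r <= n)%N -> L (jackg (m + r) * jackg (n - r)) = 0) ->
  L (polar (jackg m) (jackg n)) = - n%:R * L (jackg m * jackg n).
Proof.
elim: n m => [|n IH] m L0; first by rewrite polar_jackg0 linear0 oppr0 mul0r.
have L1 r : (r <= n)%N -> L (jackg (m.+1 + r) * jackg (n - r)) = 0.
  by move=> le_rn; have := L0 r.+1; rewrite addnS subSS; apply.
rewrite polar_jackg_rec linearB linearD !linearZ /= IH; last first.
  by move=> r /andP[_]; apply: L1.
have := L1 0%N isT; rewrite addn0 subn0 => ->.
by rewrite mulr0 scaler0 !add0r scalerN [RHS]mulNr.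
Qed.

Lemma lin_polar_prod (L : {linear A -> K^o}) k s :
    (forall r t, (0 < r)%N -> (r + sumn t = sumn s)%N -> size t = size s ->
       (forall i, (sumn (take i s) <= r + sumn (take i t))%N) ->
     L (jackg (k + r) * jackg_prod t) = 0) ->
  L (polar (jackg k) (jackg_prod s)) = - (sumn s)%:R * L (jackg k * jackg_prod s).
Proof.
elim: s L => [|m s IH] L L0.
  by rewrite /jackg_prod big_nil -jackg0 polar_jackg0 linear0 oppr0 mul0r.
rewrite jackg_prod_cons polar_M linearD /=.
have -> : L (polar (jackg k) (jackg m) * jackg_prod s) = - m%:R * L (jackg k * (jackg m * jackg_prod s)).
  rewrite [X in L X = _]mulrC -[LHS]linmulE (lin_polar_jackg (L := linmul L (jackg_prod s))) => [|r /andP[r_gt0 le_rm]].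
    by rewrite linmulE [jackg_prod s * _]mulrC mulrA.
  rewrite linmulE [jackg_prod s * _]mulrC -mulrA -jackg_prod_cons; apply: L0 => //=; first by lia.
  by case=> [|i] //=; lia.
have -> : L (jackg m * polar (jackg k) (jackg_prod s)) = - (sumn s)%:R * L (jackg k * (jackg m * jackg_prod s)).
  rewrite -[L (_ * _)]linmulE (IH (linmul L (jackg m))) => [|r t r_gt0 rt st le_st]; rewrite linmulE mulrCA //.
  rewrite -jackg_prod_cons; apply: L0 => //=; [by lia|by rewrite st|].
  by case=> [|i] //=; have := le_st i; lia.
by rewrite -mulrDl -opprD -natrD.
Qed.

(** The sum over the boxes (i, j) of s of the contents alpha (j-1) - (i-1),
    computed from the first row and the rest: adding a row on top shifts every
    box of the rest down and lowers its content by 1. *)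
Fixpoint content_sum (s : seq nat) : K :=
  if s is k :: s' then alpha * 'C(k, 2)%:R - (sumn s')%:R + content_sum s' else 0.

Lemma lin_D_cons (L : {linear A -> K^o}) k s :
    (forall r t, (0 < r)%N -> (r + sumn t = sumn s)%N -> size t = size s ->
       (forall i, (sumn (take i s) <= r + sumn (take i t))%N) ->
     L (jackg (k + r) * jackg_prod t) = 0) ->
  L (D (jackg_prod (k :: s))) = (alpha * 'C(k, 2)%:R - (sumn s)%:R) * L (jackg_prod (k :: s))
     + L (jackg k * D (jackg_prod s)).
Proof.
move=> L0; rewrite jackg_prod_cons D_M D_jackg 2!linearD /= (lin_polar_prod L0).
by rewrite -scalerAl linearZ /= /GRing.scale /= mulrDl mulNr addrAC.
Qed.

(** D acts on products of the functions g_n triangularly for dominance: all the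
    other terms arise by moving boxes to earlier factors. *)
Lemma lin_D_prod (L : {linear A -> K^o}) s :
    (forall t, sumn t = sumn s -> size t = size s -> dominated s t -> t <> s ->
       L (jackg_prod t) = 0) ->
  L (D (jackg_prod s)) = content_sum s * L (jackg_prod s).
Proof.
elim: s L => [|k s IH] L L0.
  by rewrite /jackg_prod big_nil D_1 linear0 mul0r.
rewrite lin_D_cons => [|r t r_gt0 rt st le_st]; last first.
  rewrite -jackg_prod_cons; apply: L0 => //=; [by lia|by rewrite st| |].
    by case=> [|i] //=; have := le_st i; lia.
  by case=> e; move: r_gt0; rewrite -[(0 < r)%N](ltn_add2l k) e addn0 ltnn.
rewrite -[L (_ * _)]linmulE (IH (linmul L (jackg k))) => [|t e1 e2 dst ne].
  by rewrite linmulE -jackg_prod_cons -mulrDl.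
rewrite linmulE -jackg_prod_cons; apply: L0 => /=; [by rewrite e1|by rewrite e2| |].
  by case=> [|i] //=; rewrite leq_add2l; apply: dst.
by case.
Qed.

(** * The operators of multiplication and their commutators *)

(** Normalized so that B (qsum n) f is the coefficient of p_n in f. *)
Definition qsum (k : nat) : A := (alpha * k%:R)^-1 *: p k.

Lemma D_qsum1 : D (qsum 1) = 0.
Proof. by rewrite linearZ /= D_p1 scaler0. Qed.

Definition omega1 (f : A) : A := D (qsum 1 * f) - qsum 1 * D f.

Lemma omega1E f : omega1 f = polar (qsum 1) f.
Proof. by rewrite /omega1 /polar D_qsum1 mul0r subr0. Qed.

(** This is (k+1) q_(k+1) = [Omega_1, q_k], since the commutator with D of the
    multiplication by q_1 is the derivation p_k -> k p_(k+1). *)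
Lemma omega1_qsumM k f : omega1 (qsum k.+1 * f) = k.+2%:R *: (qsum k.+2 * f) + qsum k.+1 * omega1 f.
Proof.
rewrite !omega1E polar_M; congr (_ + _); rewrite scalerAl; congr (_ * _).
rewrite /qsum linearZ /= polarC linearZ /= polar_pp !scalerA addn1; congr (_ *: _).
move: alpha_neq0 (char0 k) (char0 k.+1); rewrite muln1 mulr1.
move: (k.+1%:R : K) (k.+2%:R : K) => x y a0 x0 y0.
by field; rewrite a0 x0 y0.
Qed.

Lemma omega1_1 : omega1 1 = 0.
Proof. by rewrite /omega1 mulr1 D_qsum1 D_1 mulr0 subr0. Qed.

Lemma jackg1 : jackg 1 = qsum 1.
Proof.
have := jackg_rec (leqnn 1); rewrite big_ord1 /jackg_shift /= subnn jackg0 mulr1 => e.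
rewrite /qsum -e scalerA mulVf ?scale1r // mulr1; exact: alpha_neq0.
Qed.

Lemma d_prod k (I : eqType) (r : seq I) (F : I -> A) : uniq r ->
  d k.+1 (\prod_(i <- r) F i)
  = \sum_(i <- r) d k.+1 (F i) * \prod_(j <- r | j != i) F j.
Proof.
elim: r => [|i r IH] /=; first by rewrite !big_nil d_1.
case/andP=> ir ur; rewrite !big_cons d_M IH // eqxx /=; congr (_ * _ + _).
  rewrite big_seq [RHS]big_seq_cond; apply: eq_bigl => j.
  by rewrite andb_idr // => jr; apply: contraNneq ir => <-.
rewrite mulr_sumr; apply: eq_big_seq => j jr.
by rewrite big_cons mulrCA; case: eqP => // e; rewrite e jr in ir.
Qed.

Lemma prod_qsum s : \prod_(k <- s) qsum k
  = (alpha ^+ size s * (\prod_(k <- s) k)%N%:R)^-1 *: \prod_(k <- s) p k.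
Proof.
elim: s => [|k s IH]; first by rewrite !big_nil expr0 mulr1 invr1 scale1r.
rewrite !big_cons IH /qsum -scalerAl -scalerAr scalerA; congr (_ *: _).
by rewrite -invfM /= exprS natrM mulrACA.
Qed.

(** * The Jack basis *)

(** The triangularity of the J la on monomial functions, in the dual form of
    vanishing pairings with products of the functions g_n.  The composition s
    need not be sorted: its partial sums are at most those of its decreasing
    rearrangement. *)
Variable J : forall n, intpartn n -> A.
Hypothesis J_orth : forall m n (la : intpartn m) (mu : intpartn n),
    (la : seq nat) <> mu -> B (J la) (J mu) = 0.
Hypothesis J_dominated : forall n (la : intpartn n) s,
  B (J la) (jackg_prod s) != 0 -> sumn s = n /\ dominated s la.
Hypothesis J_col : forall n (la : intpartn n), B (J la) (jackg_prod (nseq n 1%N)) = n`!%:R.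
Hypothesis alpha_transc : forall a b a' b' : nat,
  alpha * a%:R - b%:R = alpha * a'%:R - b'%:R -> b = b'.

Lemma big_neq0_ex (I : finType) (F : I -> K) : \sum_i F i != 0 -> exists i, F i != 0.
Proof.
move=> nz; apply/existsP; apply: contraNT nz => /existsPn F0.
by rewrite big1 // => i _; have := F0 i; rewrite negbK => /eqP.
Qed.

Lemma jackg_prod0 : jackg_prod [::] = 1.
Proof. by rewrite /jackg_prod big_nil. Qed.

Lemma jackg_prod_perm s t : perm_eq s t -> jackg_prod s = jackg_prod t.
Proof. exact: perm_big. Qed.

Lemma jackg_prod_filter s : jackg_prod [seq k <- s | k != 0%N] = jackg_prod s.
Proof.
elim: s => //= k s IH; case: eqP => [->|_] /=; last by rewrite !jackg_prod_cons IH.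
by rewrite jackg_prod_cons jackg0 mul1r.
Qed.

Lemma jackg_prod_sort n s : sumn s = n -> exists la : intpartn n, jackg_prod s = jackg_prod la.
Proof.
by case/sort_partn => la /jackg_prod_perm; rewrite jackg_prod_filter => e; exists la.
Qed.

Lemma pS_jackg k : p k.+1 = (alpha * k.+1%:R) *: jackg k.+1 - \sum_(j < k) p j.+1 * jackg (k - j).
Proof. by rewrite jackgS big_ord_recr /= subnn jackg0 mulr1 addrAC subrr add0r. Qed.

(** The functions g_n generate A, again by Newton's identity. *)
Lemma lin_eq0 (L : {linear A -> K^o}) : (forall s, L (jackg_prod s) = 0) -> forall h, L h = 0.
Proof.
move=> L0 h; elim/A_ind: h L L0 => [c f h Hf Hh||k h Hh] L L0.
- by rewrite linearP Hf ?Hh // scaler0 addr0.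
- by rewrite -jackg_prod0.
rewrite -linmulE; apply: Hh => s; rewrite linmulE.
elim/ltn_ind: k s => k IH s; rewrite pS_jackg mulrBl linearB -scalerAl linearZ /=.
rewrite -jackg_prod_cons L0 scaler0 sub0r mulr_suml linear_sum big1 ?oppr0 // => j _.
by rewrite -mulrA -jackg_prod_cons IH.
Qed.

Lemma orth_jackg_eq0 f : (forall s, B f (jackg_prod s) = 0) -> f = 0.
Proof. by move=> /lin_eq0 f0; apply/B_anisotropic/f0. Qed.

(** Homogeneity of degree n, tested by pairing: products of the functions g_n of
    different degrees are orthogonal, and they span. *)
Definition homog n f := forall s, B f (jackg_prod s) != 0 -> sumn s = n.

Lemma homog_eq0 n f s : homog n f -> sumn s != n -> B f (jackg_prod s) = 0.
Proof. by move=> hf; apply: contraNeq => /hf ->. Qed.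

Lemma homogP n f : (forall s, sumn s != n -> B f (jackg_prod s) = 0) -> homog n f.
Proof. by move=> h s; apply: contraNeq => /h ->. Qed.

Lemma homog_lin n c f h : homog n f -> homog n h -> homog n (c *: f + h).
Proof.
move=> hf hh; apply: homogP => s sn; rewrite BC linearP !(BC (jackg_prod s)).
by rewrite (homog_eq0 hf) // (homog_eq0 hh) // scaler0 addr0.
Qed.

Lemma homog0 n : homog n 0.
Proof. by move=> s; rewrite BC linear0 eqxx. Qed.

Lemma homogZ n c f : homog n f -> homog n (c *: f).
Proof. by move=> hf; rewrite -[_ *: _]addr0; apply: homog_lin (homog0 n). Qed.

Lemma homogD n f h : homog n f -> homog n h -> homog n (f + h).
Proof. by move=> hf; rewrite -[f]scale1r; apply: homog_lin. Qed.

Lemma homog_sum n (I : Type) (r : seq I) (P : pred I) F :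
  (forall i, P i -> homog n (F i)) -> homog n (\sum_(i <- r | P i) F i).
Proof. by move=> hF; elim/big_rec: _ => [|i x Pi]; [apply: homog0|apply/homogD/hF]. Qed.

Lemma lin_d_prod (L : {linear A -> K^o}) k s :
    (forall t, (sumn t + k.+1 = sumn s)%N -> L (jackg_prod t) = 0) ->
  L (d k.+1 (jackg_prod s)) = 0.
Proof.
elim: s L => [|m s IH] L L0; first by rewrite /jackg_prod big_nil d_1 linear0.
rewrite jackg_prod_cons d_M linearD /= -[L (jackg m * _)]linmulE (IH (linmul L (jackg m))); last first.
  by move=> t e; rewrite linmulE -jackg_prod_cons; apply: L0 => /=; lia.
rewrite addr0 d_jackg -scalerAl linearZ /= /jackg_shift; case: leqP => [_|le_km]; first by rewrite mul0r linear0 scaler0.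
by rewrite -jackg_prod_cons L0 ?scaler0 //=; lia.
Qed.

Lemma homog_pM k n f : homog n f -> homog (k.+1 + n) (p k.+1 * f).
Proof.
move=> hf; apply: homogP => s sn; rewrite B_pM lin_d_prod ?mulr0 // => t e.
by apply: (homog_eq0 hf); lia.
Qed.

Lemma homog_jackgM k n f : homog n f -> homog (k + n) (jackg k * f).
Proof.
elim/ltn_ind: k f n => -[|k] IH f n hf; first by rewrite jackg0 mul1r.
have an : alpha * k.+1%:R != 0 by rewrite mulf_neq0 ?alpha_neq0 ?char0.
rewrite -[jackg _]scale1r -(mulVf an) -scalerA jackgS -scalerAl mulr_suml.
apply/homogZ/homog_sum => j _; rewrite -mulrA.
have -> : (k.+1 + n = j.+1 + (k - j + n))%N by have := ltn_ord j; lia.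
by apply/homog_pM/IH => //; lia.
Qed.

Lemma homog_1 : homog 0 1.
Proof.
apply: homogP; elim=> [|[|k] s IH] //= sn; first by rewrite jackg_prod_cons jackg0 mul1r IH.
have an : alpha * k.+1%:R != 0 by rewrite mulf_neq0 ?alpha_neq0 ?char0.
apply: (mulfI an); rewrite mulr0 jackg_prod_cons -[LHS]linearZ /= scalerAl jackgS.
rewrite mulr_suml linear_sum big1 // => j _.
by rewrite -mulrA B_Mp d_1 BC linear0 mulr0.
Qed.

Lemma homog_jackg_prod s : homog (sumn s) (jackg_prod s).
Proof.
elim: s => [|k s IH]; first by rewrite /jackg_prod big_nil; apply: homog_1.
by rewrite jackg_prod_cons; apply: homog_jackgM.
Qed.

Lemma homog_J n (la : intpartn n) : homog n (J la).
Proof. by move=> s /J_dominated[]. Qed.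

Definition sqnorm n (la : intpartn n) : K := B (J la) (J la).

Lemma sqnorm_neq0 n (la : intpartn n) : sqnorm la != 0.
Proof.
apply/eqP => /B_anisotropic J0; have := J_col la; rewrite J0 BC linear0.
by apply/eqP; rewrite eq_sym natK_neq0 // fact_gt0.
Qed.

(** The Jack functions of degree n against the products of the functions g_n. *)
Definition triang_mx n : 'M[K]_#|{: intpartn n}| :=
  \matrix_(i, j) B (J (enum_val i)) (jackg_prod (enum_val j : intpartn n)).

Lemma J_sum_coef n (c : intpartn n -> K) (mu : intpartn n) :
  B (\sum_la c la *: J la) (J mu) = c mu * sqnorm mu.
Proof.
rewrite BC linear_sum (bigD1 mu) //= linearZ /= big1 ?addr0 // => la ne.
rewrite linearZ /= J_orth ?scaler0 // => e; case/eqP: ne.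
by apply: intpartn_inj.
Qed.

(** A combination of Jack functions that is orthogonal to every product of the
    functions g_n vanishes, and Jack functions are independent because they are
    orthogonal and anisotropic. *)
Lemma triang_mx_unit n : triang_mx n \in unitmx.
Proof.
rewrite -row_free_unit; apply: inj_row_free => v vT0.
pose c (la : intpartn n) := v 0 (enum_rank la).
have f0 : \sum_la c la *: J la = 0.
  apply: orth_jackg_eq0 => s; have hf : homog n (\sum_la c la *: J la).
    by apply: homog_sum => la _; apply/homogZ/homog_J.
  case: (eqVneq (sumn s) n) => [sn|]; last exact: homog_eq0.
  have [mu ->] := jackg_prod_sort sn; rewrite BC linear_sum /=.
  transitivity ((v *m triang_mx n) 0 (enum_rank mu)); last by rewrite vT0 mxE.
  rewrite mxE (reindex (@enum_val _ {: intpartn n})) /=; last first.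
    by exists enum_rank => i _; [apply: enum_valK|apply: enum_rankK].
  apply: eq_bigr => i _; rewrite linearZ /= mxE /c enum_valK enum_rankK.
  by rewrite BC.
apply/rowP => i; rewrite mxE; have := J_sum_coef c (enum_val i).
rewrite f0 BC linear0 /c enum_valK => /esym/eqP.
by rewrite mulf_eq0 (negPf (sqnorm_neq0 _)) orbF => /eqP.
Qed.

(** The determinant of [triang_mx] has a nonzero term in its Leibniz expansion.
    The permutation of that term can only lower the partitions, so it lowers
    none of their weights and is the identity. *)
Lemma J_diag n (la : intpartn n) : B (J la) (jackg_prod la) != 0.
Proof.
have := triang_mx_unit n; rewrite unitmxE unitfE /determinant => /eqP detT.
have [s /prodf_neq0 Ts] : exists s : 'S_#|{: intpartn n}|,
    \prod_i triang_mx n i (s i) != 0.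
  apply/existsP; apply: contra_notT detT => /existsPn Ts.
  by rewrite big1 // => s _; have := Ts s; rewrite negbK => /eqP ->; rewrite mulr0.
pose W (i : 'I_#|{: intpartn n}|) := dom_weight n (enum_val i : intpartn n).
have dom i : dominated (enum_val (s i) : intpartn n) (enum_val i : intpartn n).
  by have := Ts i isT; rewrite mxE => /J_dominated[].
have le i : (W (s i) <= W i)%N by apply/dominated_weight/dom.
have : (\sum_i (W i - W (s i)) == 0)%N.
  by rewrite sumnB // [X in (X - _)%N](reindex_inj (@perm_inj _ s)) subnn.
rewrite sum_nat_eq0 => /forallP/(_ (enum_rank la)) /=; rewrite subn_eq0 => ge.
have := Ts (enum_rank la) isT; rewrite mxE.
by rewrite (dominated_eq (dom _) ge) enum_rankK.
Qed.

(** The Jack functions span, as the products of the functions g_n separate points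
    and [triang_mx] is invertible. *)
Lemma J_complete n f : homog n f ->
  f = \sum_(la : intpartn n) (B f (J la) / sqnorm la) *: J la.
Proof.
move=> hf; pose r := \row_(j < #|{: intpartn n}|) B f (jackg_prod (enum_val j)).
have [w wT] : exists w, w *m triang_mx n = r.
  by exists (r *m invmx (triang_mx n)); rewrite mulmxKV ?triang_mx_unit.
pose c (la : intpartn n) := w 0 (enum_rank la).
have fE : f = \sum_la c la *: J la.
  apply/eqP; rewrite -subr_eq0; apply/eqP/orth_jackg_eq0 => s.
  rewrite BC linearB /= !(BC (jackg_prod s)).
  have hS : homog n (\sum_la c la *: J la).
    by apply: homog_sum => la _; apply/homogZ/homog_J.
  case: (eqVneq (sumn s) n) => [sn|ne]; last by rewrite (homog_eq0 hf) // (homog_eq0 hS) // subr0.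
  have [mu ->] := jackg_prod_sort sn; rewrite [X in _ - X]BC linear_sum /=.
  apply/eqP; rewrite subr_eq0; apply/eqP.
  transitivity ((w *m triang_mx n) 0 (enum_rank mu)); first by rewrite wT mxE enum_rankK.
  rewrite mxE [RHS](reindex (@enum_val _ {: intpartn n})) /=; last first.
    by exists enum_rank => i _; [apply: enum_valK|apply: enum_rankK].
  apply: eq_bigr => i _; rewrite linearZ /= mxE /c enum_valK enum_rankK.
  by rewrite BC.
rewrite {1}fE; apply: eq_bigr => la _.
by rewrite fE J_sum_coef mulfK ?sqnorm_neq0.
Qed.

Lemma J_expand n h f : homog n h ->
  B f h = \sum_(la : intpartn n) B h (J la) / sqnorm la * B f (J la).
Proof.
move=> hh; rewrite {1}(J_complete hh) linear_sum; apply: eq_bigr => la _.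
by rewrite linearZ.
Qed.

Lemma lin_expand n h (L : {linear A -> K^o}) : homog n h ->
  L h = \sum_(la : intpartn n) B h (J la) / sqnorm la * L (J la).
Proof.
move=> hh; rewrite {1}(J_complete hh) linear_sum; apply: eq_bigr => la _.
by rewrite linearZ.
Qed.

Lemma homog_jackg_prodn n s : sumn s = n -> homog n (jackg_prod s).
Proof. by move=> <-; apply: homog_jackg_prod. Qed.

(** Triangularity against products of the functions g_n passes to the Jack
    functions.  When L vanishes at g_ka, the expansion of g_ka in Jack functions
    contains a strictly larger mu with L (J mu) <> 0, whence the induction on
    the weight. *)
Lemma J_support n (L : {linear A -> K^o}) (Q : intpartn n -> Prop) :
    (forall ka mu : intpartn n, dominated ka mu -> Q mu -> Q ka) ->
    (forall mu : intpartn n, L (jackg_prod mu) != 0 -> Q mu) ->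
  forall ka : intpartn n, L (J ka) != 0 -> Q ka.
Proof.
move=> Qdom Qg ka; have [m] := ubnP ((n * n).+1 - dom_weight n ka).
elim: m ka => // m IH ka ltm Lka.
case: (eqVneq (L (jackg_prod ka)) 0) => [|]; last exact: Qg.
rewrite (lin_expand L (homog_jackg_prodn (sumn_intpartn ka))) (bigD1 ka) //= => /eqP.
rewrite addrC addr_eq0 => /eqP e.
have : \sum_(i | i != ka) B (jackg_prod ka) (J i) / sqnorm i * L (J i) != 0.
  by rewrite e oppr_eq0 !mulf_neq0 ?invr_eq0 ?sqnorm_neq0 // BC J_diag.
rewrite big_mkcond => /big_neq0_ex[mu].
have [->|ne] := eqVneq mu ka; first by rewrite !eqxx.
rewrite /= !mulf_eq0 !negb_or -andbA => /and3P[T_neq0 _ Lmu].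
have dom : dominated ka mu by move: T_neq0; rewrite BC => /J_dominated[].
(* The strictly larger partition has Q by induction, and Q is closed downwards. *)
apply: (Qdom _ _ dom); apply: IH => //.
have ltw : (dom_weight n ka < dom_weight n mu)%N.
  by rewrite ltnNge; apply: contra ne => /(dominated_eq dom) ->.
have := dom_weight_leg mu; lia.
Qed.

Lemma B_D_gprod n (la : intpartn n) s :
  B (J la) (D (jackg_prod s)) != 0 -> sumn s = n /\ dominated s la.
Proof.
move=> nz; case: (boolP ((sumn s == n) && dominatedb s la)).
  by case/andP=> /eqP-> /dominatedP.
rewrite negb_and => h; case/eqP: nz.
rewrite lin_D_prod => [|t e1 e2 dst ne].
  apply/eqP; rewrite mulf_eq0; apply/orP; right; apply: contraLR h => nz.
  by have [-> /dominatedP ->] := J_dominated nz; rewrite eqxx.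
apply/eqP; apply: contraLR h => nz; have [tn dt] := J_dominated nz.
rewrite negb_or !negbK -e1 tn eqxx.
by apply/dominatedP/(dominated_trans dst).
Qed.

Lemma homog_DJ n (la : intpartn n) : homog n (D (J la)).
Proof. by move=> s; rewrite D_adj => /B_D_gprod[]. Qed.

Lemma DJ_dominated n (la mu : intpartn n) :
  B (D (J la)) (J mu) != 0 -> dominated mu la.
Proof.
apply: (@J_support n (B (D (J la))) (fun mu => dominated mu la)).
  by move=> ka nu d1 d2; apply: dominated_trans d1 d2.
by move=> nu; rewrite D_adj => /B_D_gprod[].
Qed.

(** D preserves both the triangular spaces and orthogonality, so J is an
    eigenfunction; the eigenvalue is read off from the pairing with g_la. *)
Lemma D_J n (la : intpartn n) : D (J la) = content_sum la *: J la.
Proof.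
pose c := B (D (J la)) (J la) / sqnorm la.
have DE : D (J la) = c *: J la.
  rewrite [LHS](J_complete (@homog_DJ _ la)) (bigD1 la) //= big1 ?addr0 // => mu ne.
  case: (eqVneq (B (D (J la)) (J mu)) 0) => [->|nz]; first by rewrite mul0r scale0r.
  case/eqP: ne; apply: dominated_anti; first exact: DJ_dominated.
  by apply: DJ_dominated; rewrite D_adj BC.
have : B (D (J la)) (jackg_prod la) = content_sum la * B (J la) (jackg_prod la).
  rewrite D_adj lin_D_prod // => t e1 e2 dst ne.
  apply/eqP; apply/negPn/negP => nz; have [tn dt] := J_dominated nz.
  by case: ne; apply: eq_partial_sums => // k; apply/anti_leq; rewrite dst dt.
rewrite DE BC linearZ /= (BC (jackg_prod la)) => /(mulIf (J_diag la)) <-.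
by [].
Qed.

Lemma content_sumE s : content_sum s = alpha * (arm_sum s)%:R - (leg_sum s)%:R.
Proof.
elim: s => [|k s IH] /=; first by rewrite mulr0 subrr.
by rewrite IH !natrD; ring.
Qed.

(** Equal eigenvalues have equal leg statistics by [alpha_transc], hence equal
    weights. *)
Lemma content_sum_inj n (la mu : intpartn n) : dominated la mu ->
  content_sum la = content_sum mu -> la = mu.
Proof.
rewrite !content_sumE => dom /alpha_transc e; apply: (dominated_eq dom).
by have := dom_weight_leg la; have := dom_weight_leg mu; lia.
Qed.

(** * Removing the first row *)

(** No composition that starts with j is dominated by a partition whose first
    row is shorter. *)
Lemma row_vanish n (ga : intpartn n) j h : (head 0%N ga < j)%N -> B (J ga) (jackg j * h) = 0.
Proof.
move=> lt_j; rewrite -linmulE; apply: lin_eq0 => s; rewrite linmulE -jackg_prod_cons.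
apply/eqP/negPn/negP => /J_dominated[_ /(_ 1%N)] /=; rewrite take0 addn0.
by case: (ga : seq nat) lt_j => [|k t] /=; rewrite ?take0 /= ?addn0 => *; lia.
Qed.

(** A degenerate case of [J_support]. *)
Lemma lin_eq0_J n (L : {linear A -> K^o}) : (forall s, sumn s = n -> L (jackg_prod s) = 0) ->
  forall mu : intpartn n, L (J mu) = 0.
Proof.
move=> L0 mu; apply/eqP/negPn/negP => nz.
apply: (@J_support n L (fun=> False)) nz => // ka.
by rewrite L0 ?eqxx // sumn_intpartn.
Qed.

(** Let L be the functional h -> B (J ga) (g k * h).  In D (g k * h) all the
    terms that raise the factor g k are killed by J ga, so L intertwines D with
    the multiplication by the eigenvalue of ga'. *)
Lemma row_eigen k m n (ga : intpartn n) (ga' mu : intpartn m) :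
    ga = k :: ga' :> seq nat ->
  (content_sum mu - content_sum ga') * B (J ga) (jackg k * J mu) = 0.
Proof.
move=> e.
pose L : {linear A -> K^o} := linmul (B (J ga)) (jackg k).
pose M : {linear A -> K^o} := (L \o D) \- (content_sum ga' \*: L).
suff : M (J mu) = 0.
  by rewrite mulrBl /M /= D_J -scalerAr linearZ.
apply: lin_eq0_J => s sm; rewrite /M /=.
have L0 r t : (0 < r)%N -> B (J ga) (jackg (k + r) * jackg_prod t) = 0.
  by move=> r_gt0; apply: row_vanish; rewrite e /=; lia.
have := @lin_D_cons (B (J ga)) k s (fun r t r_gt0 _ _ _ => L0 r t r_gt0).
rewrite -D_adj D_J BC linearZ /= (BC _ (J ga)) e /= sumn_intpartn sm.
rewrite jackg_prod_cons /GRing.scale /= mulrDl => h.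
by rewrite -(addrI _ h) subrr.
Qed.

(** The eigenvalue of mu must be that of ga', and mu is dominated by ga' because
    k :: mu is dominated by ga. *)
Lemma row_removal k m n (ga : intpartn n) (ga' mu : intpartn m) :
    ga = k :: ga' :> seq nat ->
  B (J ga) (jackg k * J mu) != 0 -> mu = ga'.
Proof.
move=> e nz; have dom : dominated mu ga'.
  apply: (@J_support m (linmul (B (J ga)) (jackg k)) (fun mu => dominated mu ga')) nz.
    by move=> ka nu d1 d2; apply: dominated_trans d1 d2.
  move=> nu; rewrite linmulE -jackg_prod_cons => /J_dominated[_ dom] i.
  by have := dom i.+1; rewrite e /= leq_add2l.
apply: content_sum_inj dom _; apply/eqP; rewrite -subr_eq0.
by have /eqP := row_eigen mu e; rewrite mulf_eq0 (negPf nz) orbF.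
Qed.

Lemma row_removal_neq0 k m n (ga : intpartn n) (ga' : intpartn m) :
  ga = k :: ga' :> seq nat -> B (J ga) (jackg k * J ga') != 0.
Proof.
move=> e; have := J_diag ga; rewrite e jackg_prod_cons -linmulE.
rewrite (lin_expand _ (homog_jackg_prodn (sumn_intpartn ga'))) => /big_neq0_ex[mu].
rewrite linmulE mulf_eq0 negb_or => /andP[_ nz].
by move: (nz); rewrite (row_removal e nz).
Qed.

(** * The Pieri rule for the first power sum *)

Lemma B_qsum1 f h : B (qsum 1 * f) h = B f (d 1 h).
Proof.
by rewrite /qsum -scalerAl BC linearZ /= BC B_pM mulr1 /GRing.scale /= mulKf ?alpha_neq0.
Qed.

(** Up to normalization, the coefficient of J gb in q 1 * J ga. *)
Definition edge m n (ga : intpartn m) (gb : intpartn n) := B (qsum 1 * J ga) (J gb).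

(** The multiplication by q 1 = g 1 appends a part 1 to a composition. *)
Lemma edge_head_le m n (ga : intpartn m) (gb : intpartn n) : edge ga gb != 0 ->
  (head 0%N ga <= head 0%N gb)%N.
Proof.
rewrite /edge BC -linmulE.
apply: (@J_support m _ (fun mu => (head 0%N mu <= head 0%N gb)%N)) => [ka mu|mu].
  by move=> /dominated_head; apply: leq_trans.
rewrite linmulE mulrC -jackg1 -[jackg 1]mulr1 -jackg_prod0 -jackg_prod_cons /jackg_prod -big_cat -/(jackg_prod _).
case/J_dominated=> _ /dominated_head; case: (mu : seq nat) => //=.
Qed.

(** The adjoint derivation d 1 lowers one factor g m to g (m - 1). *)
Lemma edge_head_ge m n (ga : intpartn m) (gb : intpartn n) : edge ga gb != 0 ->
  (head 0%N gb <= (head 0%N ga).+1)%N.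
Proof.
apply: (@J_support n (B (qsum 1 * J ga)) (fun mu => (head 0%N mu <= (head 0%N ga).+1)%N)).
  by move=> ka mu /dominated_head; apply: leq_trans.
move=> mu; apply: contraR; rewrite -ltnNge.
case: (mu : seq nat) => // k s /= ltk; rewrite B_qsum1 jackg_prod_cons d_M linearD /=.
rewrite [X in _ + X]row_vanish ?addr0 1?ltnW // d_jackg -scalerAl linearZ /=.
by rewrite /jackg_shift; case: leqP => _; rewrite ?mul0r ?linear0 ?row_vanish ?scaler0 //; lia.
Qed.

(** Compare two expansions of B (J gb) (q 1 * g k * J ta), by the Jack expansion
    of q 1 * J ta and by that of g k * J ta.  Row removal leaves one term in
    each: the edge from ta to tb and the edge from ga to gb. *)
Lemma edge_tail k m n a b (ga : intpartn a) (gb : intpartn b)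
    (ta : intpartn m) (tb : intpartn n) : n = m.+1 ->
    ga = k :: ta :> seq nat -> gb = k :: tb :> seq nat ->
  edge ga gb != 0 -> edge ta tb != 0.
Proof.
move=> nm ea eb nz.
have S1 : B (J gb) (qsum 1 * (jackg k * J ta)) != 0.
  have [k_gt0 ae _] := behead_partn ea (sumn_intpartn ta).
  have hh : homog a (jackg k * J ta) by rewrite ae; apply: homog_jackgM; apply: homog_J.
  rewrite -linmulE (lin_expand _ hh) (bigD1 ga) //= big1 ?addr0 => [|rho ne].
    rewrite ?linmulE !mulf_neq0 ?invr_eq0 ?sqnorm_neq0 //.
      by rewrite BC row_removal_neq0.
    by move: nz; rewrite /edge BC.
  rewrite ?linmulE; apply/eqP; apply: contraR ne.
  rewrite !mulf_eq0 !negb_or -andbA BC => /and3P[nz1 _ nz2].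
  have le1 : (k <= head 0%N rho)%N.
    by rewrite leqNgt; apply: contra nz1 => lt; rewrite row_vanish.
  have := edge_head_le (m := a) (ga := rho) (gb := gb); rewrite /edge BC => /(_ nz2).
  rewrite eb /= => le2.
  have [s es] : exists s, rho = k :: s :> seq nat.
    move: le1 le2; case: (rho : seq nat) => [|x s] /=; first by case: (k) k_gt0.
    by move=> h1 h2; exists s; congr (_ :: _); apply/anti_leq/andP.
  have ss : sumn s = m by have := sumn_intpartn rho; rewrite es /=; lia.
  have [_ _ [c ec]] := behead_partn es ss.
  apply/eqP/intpartn_inj; rewrite es ea -ec; congr (_ :: _).
  rewrite -ec in es; by rewrite (row_removal es nz1).
move: S1; rewrite mulrCA -linmulE.
have hh : homog n (qsum 1 * J ta).
  by rewrite nm -jackg1 -add1n; apply: homog_jackgM; apply: homog_J.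
rewrite (lin_expand _ hh) => /big_neq0_ex[mu]; rewrite linmulE.
rewrite !mulf_eq0 !negb_or -andbA => /and3P[nz1 _ nz2].
by move: nz1; rewrite (row_removal eb nz2).
Qed.

(** Expand g k * J tb in Jack functions: the only one that occurs and is joined
    to ga by an edge is J gb.  On the other hand d 1, the adjoint of q 1, must
    hit the factor g k, as J ga is orthogonal to all multiples of g k. *)
Lemma edge_first k n a b (ga : intpartn a) (gb : intpartn b) (tb : intpartn n) :
    gb = k :: tb :> seq nat -> (head 0%N ga < k)%N ->
  edge ga gb != 0 -> B (J ga) (jackg k.-1 * J tb) != 0.
Proof.
move=> eb ltk nz; have [k_gt0 be _] := behead_partn eb (sumn_intpartn tb).
have hh : homog b (jackg k * J tb) by rewrite be; apply: homog_jackgM; apply: homog_J.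
have S1 : B (qsum 1 * J ga) (jackg k * J tb) != 0.
  rewrite (lin_expand _ hh) (bigD1 gb) //= big1 ?addr0 => [|rho ne].
    by rewrite !mulf_neq0 ?invr_eq0 ?sqnorm_neq0 // BC row_removal_neq0.
  apply/eqP; apply: contraR ne.
  rewrite !mulf_eq0 !negb_or -andbA BC => /and3P[nz1 _ nz2].
  have le1 : (k <= head 0%N rho)%N.
    by rewrite leqNgt; apply: contra nz1 => lt; rewrite row_vanish.
  have le2 := edge_head_ge nz2.
  have [s es] : exists s, rho = k :: s :> seq nat.
    move: le1 le2; case: (rho : seq nat) => [|x s] /=; first by case: (k) k_gt0.
    by move=> h1 h2; exists s; congr (_ :: _); apply/anti_leq/andP; split => //; lia.
  have ss : sumn s = n by have := sumn_intpartn rho; rewrite es /=; lia.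
  have [_ _ [c ec]] := behead_partn es ss.
  apply/eqP/intpartn_inj; rewrite es eb -ec; congr (_ :: _).
  rewrite -ec in es; by rewrite (row_removal es nz1).
move: S1; rewrite B_qsum1 d_M linearD /= [X in _ + X]row_vanish // addr0.
rewrite d_jackg -scalerAl linearZ /= /jackg_shift k_gt0 subn1 mulf_eq0 negb_or.
by case/andP.
Qed.

(** When the first rows agree they are removed from both diagrams; otherwise the
    box has been added to the first row and the other rows agree. *)
Lemma pieri n (ga : intpartn n) (gb : intpartn n.+1) : edge ga gb != 0 ->
  exists2 i, (i <= size ga)%N & gb = incr_nth ga i :> seq nat.
Proof.
elim/ltn_ind: n ga gb => n IH ga gb nz.
have := edge_head_le nz; have := edge_head_ge nz.
case eb: (gb : seq nat) => [|k' b].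
  by have := sumn_intpartn gb; rewrite eb.
have [m em] : exists m, sumn b = m by exists (sumn b).
have [k'_gt0 nE [tb etb]] := behead_partn eb em; subst b => /= le2 le1.
case: (ltnP (head 0%N ga) k') => [lt_k|ge_k].
  have k'E : k' = (head 0%N ga).+1 by apply/anti_leq/andP.
  have nz1 := edge_first eb lt_k nz; exists 0%N => //.
  move: nz1 k'E; case ea: (ga : seq nat) => [|k a] /= nz1 k'E.
    have := size_le_sumn (intpartn_neq0 tb); rewrite sumn_intpartn k'E.
    have := sumn_intpartn ga; rewrite ea /= => n0.
    by move=> le_m; have /size0nil -> : size tb = 0%N by lia.
  have ss : sumn a = m by have := sumn_intpartn ga; rewrite ea /=; lia.
  have [_ _ [ta eta_]] := behead_partn ea ss; subst a.
  rewrite k'E /= in nz1.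
  by rewrite k'E (row_removal ea nz1).
have hE : head 0%N ga = k' by apply/anti_leq/andP.
case ea: (ga : seq nat) => [|k a]; first by move: hE; rewrite ea /=; lia.
have kE : k = k' by move: hE; rewrite ea.
have [l el] : exists l, sumn a = l by exists (sumn a).
have [_ nE' [ta eta_]] := behead_partn ea el; subst a k.
have ml : m = l.+1 by lia.
subst m; have [|i le_i ei] := IH l _ ta tb (edge_tail (erefl _) ea eb nz).
  by lia.
by exists i.+1; rewrite //= ei.
Qed.

(** The content of the box added at the end of row i. *)
Definition new_content (s : seq nat) i : K := alpha * (nth 0%N s i)%:R - i%:R.

Lemma content_sum_incr s i : (i <= size s)%N ->
  content_sum (incr_nth s i) = content_sum s + new_content s i.
Proof.
rewrite /new_content; elim: s i => [|k s IH] [|i] //=.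
- by rewrite !mulr0 !subr0 !addr0.
- by move=> _; rewrite binS bin1 natrD subr0; ring.
- by rewrite ltnS => /IH ->; rewrite sumn_incr_nth -!natr1; ring.
Qed.

(** The product of the contents of the boxes of s, its first row having index r. *)
Fixpoint content_prod (r : nat) (s : seq nat) : K :=
  if s is k :: s' then
    (\prod_(j < k) (alpha * j%:R - r%:R)) * content_prod r.+1 s'
  else 1.

Lemma content_prod_incr r s i : (i <= size s)%N -> content_prod r (incr_nth s i)
  = content_prod r s * (alpha * (nth 0%N s i)%:R - (r + i)%:R).
Proof.
elim: s r i => [|k s IH] r [|i] //=.
- by rewrite big_ord1 addn0 mulr1 mul1r.
- by move=> _; rewrite big_ord_recr /= addn0 mulrAC.
- by rewrite ltnS => /IH ->; rewrite addnS addSn mulrA.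
Qed.

(** The product of the contents of all the boxes but the corner, whose content
    is 0. *)
Definition reduced_prod (s : seq nat) : K :=
  if s is k :: s' then
    (\prod_(j < k.-1) (alpha * j.+1%:R)) * content_prod 1 s'
  else 1.

Lemma reduced_prod_incr s i : (0 < head 0%N s)%N -> (i <= size s)%N ->
  reduced_prod (incr_nth s i) = reduced_prod s * new_content s i.
Proof.
rewrite /new_content; case: s i => [|[|k] s] [|i] //= _ le_i.
- by rewrite big_ord_recr /= subr0 mulrAC.
- by rewrite content_prod_incr // mulrA.
Qed.

Definition content_jump m n (ga : intpartn m) (gb : intpartn n) : K :=
  content_sum gb - content_sum ga.

(** The jump of the sum of contents along an edge is the content of the new box. *)
Lemma edge_reduced_prod n (ga : intpartn n) (gb : intpartn n.+1) : (0 < n)%N ->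
  reduced_prod ga * content_jump ga gb * edge ga gb = reduced_prod gb * edge ga gb.
Proof.
move=> n_gt0; case: (eqVneq (edge ga gb) 0) => [->|/pieri[i le_i eb]].
  by rewrite !mulr0.
have hd : (0 < head 0%N ga)%N.
  have := sumn_intpartn ga; have := intpartn_neq0 ga.
  by case: (ga : seq nat) => [|[|k] s] //= _; lia.
by rewrite /content_jump eb content_sum_incr // reduced_prod_incr // addrAC subrr add0r.
Qed.

(** * Path products of contents and the operator they define *)

Lemma homog_qsum1M n f : homog n f -> homog n.+1 (qsum 1 * f).
Proof. by rewrite -jackg1 -add1n; apply: homog_jackgM. Qed.

Lemma homog_d1 n f : homog n.+1 f -> homog n (d 1 f).
Proof.
by move=> hf s; rewrite BC -B_qsum1 -jackg1 -jackg_prod_cons BC => /hf /= [].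
Qed.

Lemma homog_D n f : homog n f -> homog n (D f).
Proof.
move=> hf; rewrite (J_complete hf) linear_sum; apply: homog_sum => la _.
by rewrite linearZ /= D_J scalerA; apply/homogZ/homog_J.
Qed.

Lemma homogB n f h : homog n f -> homog n h -> homog n (f - h).
Proof. by move=> hf hh; rewrite addrC -scaleN1r; apply: homog_lin. Qed.

Lemma homog_ext n f h : homog n f -> homog n h ->
  (forall la : intpartn n, B f (J la) = B h (J la)) -> f = h.
Proof.
move=> hf hh e; rewrite (J_complete hf) (J_complete hh).
by apply: eq_bigr => la _; rewrite e.
Qed.

(** X raises degrees by one, and its matrix entry along an edge is that of the
    multiplication by q 1 times the value of x at the content of the added box. *)
Definition has_symbol (X : A -> A) (x : K -> K) :=
  (forall n f, homog n f -> homog n.+1 (X f)) /\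
  forall n f (gb : intpartn n.+1), B (X f) (J gb) =
    \sum_(ga : intpartn n) edge ga gb / sqnorm ga * x (content_jump ga gb) * B f (J ga).

Lemma symbol_qsum1 : has_symbol ( *%R (qsum 1)) (fun=> 1).
Proof.
split=> [n f|n f gb]; first exact: homog_qsum1M.
rewrite B_qsum1 (J_expand _ (homog_d1 (@homog_J _ gb))); apply: eq_bigr => ga _.
by rewrite mulr1 BC -B_qsum1.
Qed.

Definition bracket (X Y : A -> A) f := X (Y f) - Y (X f).

(** D is diagonal, so its commutator with X multiplies an entry by the difference
    of the two eigenvalues. *)
Lemma symbol_bracket X x : has_symbol X x -> has_symbol (bracket D X) (fun t => t * x t).
Proof.
case=> hX eX; split=> [n f hf|n f gb].
  by apply: homogB; [apply/homog_D/hX|apply/hX/homog_D].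
rewrite /bracket BC linearB /= !(BC (J gb)) D_adj D_J linearZ /= !eX.
rewrite /GRing.scale /= mulr_sumr -sumrB; apply: eq_bigr => ga _.
rewrite D_adj D_J [B f _]linearZ /= /content_jump /GRing.scale /=; ring.
Qed.

Definition delta := bracket D omega1.

Lemma symbol_omega1 : has_symbol omega1 id.
Proof.
have [h e] := symbol_bracket symbol_qsum1; split=> // n f gb; rewrite e.
by apply: eq_bigr => ga _; rewrite mulr1.
Qed.

Lemma symbol_delta : has_symbol delta (fun t => t * t).
Proof. exact: symbol_bracket symbol_omega1. Qed.

(** The diagonal operator Phi, restricted to degree n and extended by 0 to the
    other degrees. *)
Definition content_op n f : A :=
  \sum_(ga : intpartn n) (reduced_prod ga / sqnorm ga * B f (J ga)) *: J ga.

Lemma homog_content_op n f : homog n (content_op n f).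
Proof. by apply: homog_sum => ga _; apply/homogZ/homog_J. Qed.

Lemma content_op_is_linear n : linear (content_op n).
Proof.
move=> c f h; rewrite /content_op scaler_sumr -big_split; apply: eq_bigr => ga _ /=.
rewrite !(BC _ (J ga)) linearP /= scalerA -scalerDl; congr (_ *: _).
by rewrite /GRing.scale /=; ring.
Qed.

HB.instance Definition _ n := GRing.isLinear.Build K A A *:%R (content_op n) (content_op_is_linear n).

Lemma B_content_op n f (ga : intpartn n) : B (content_op n f) (J ga) = reduced_prod ga * B f (J ga).
Proof. by rewrite J_sum_coef mulrAC divfK ?sqnorm_neq0. Qed.

(** Passing through Phi multiplies an entry by the ratio of the reduced content
    products, which is the content of the added box; in degree 0 this fails, as
    that box is the corner. *)
Lemma content_op_symbol n f X Y x : (0 < n)%N -> has_symbol X x ->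
  has_symbol Y (fun t => t * x t) -> content_op n.+1 (X f) = Y (content_op n f).
Proof.
move=> n_gt0 [hX eX] [hY eY]; apply: homog_ext => [||gb]; first exact: homog_content_op.
  exact/hY/homog_content_op.
rewrite B_content_op eX eY mulr_sumr; apply: eq_bigr => ga _; rewrite B_content_op.
have := edge_reduced_prod ga gb n_gt0.
move: (reduced_prod ga) (reduced_prod gb) (content_jump ga gb) (edge ga gb) => a b t e h.
have -> : b * (e / sqnorm ga * x t * B f (J ga)) = (b * e) / sqnorm ga * x t * B f (J ga).
  by ring.
by rewrite -h; ring.
Qed.

Lemma content_op_qsum1 n f : (0 < n)%N -> content_op n.+1 (qsum 1 * f) = omega1 (content_op n f).
Proof.
move=> n_gt0; apply: content_op_symbol n_gt0 symbol_qsum1 _.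
have [h e] := symbol_omega1; split=> // m f' gb; rewrite e.
by apply: eq_bigr => ga _; rewrite mulr1.
Qed.

Lemma content_op_omega1 n f : (0 < n)%N -> content_op n.+1 (omega1 f) = delta (content_op n f).
Proof. by move=> n_gt0; apply: content_op_symbol n_gt0 symbol_omega1 symbol_delta. Qed.

Lemma B_jackg1n n (ga : intpartn n) : B (jackg_prod (nseq n 1%N)) (J ga) = n`!%:R.
Proof. by rewrite BC J_col. Qed.

(** q_1^n pairs to n! with every Jack function of degree n.  Expand it in Jack
    functions, multiply by q_1 and pair the result with J gb. *)
Lemma sum_edge n (gb : intpartn n.+1) :
  \sum_(ga : intpartn n) edge ga gb / sqnorm ga = n.+1%:R.
Proof.
have n_neq0 : n`!%:R != 0 :> K by rewrite natK_neq0 ?fact_gt0.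
have hg : homog n (jackg_prod (nseq n 1%N)) by apply: homog_jackg_prodn; rewrite sumn_nseq mul1n.
apply: (mulIf n_neq0); rewrite -natrM -factS -(B_jackg1n gb) jackg_prod_cons jackg1.
have [_ ->] := symbol_qsum1; rewrite mulr_suml; apply: eq_bigr => ga _.
by rewrite mulr1 B_jackg1n.
Qed.

Lemma omega1_qsum k : omega1 (qsum k.+1) = k.+2%:R *: qsum k.+2.
Proof. by rewrite -[qsum k.+1]mulr1 omega1_qsumM omega1_1 mulr0 addr0 mulr1. Qed.

Lemma homog_qsum k : homog k.+1 (qsum k.+1).
Proof. by apply: homogZ; rewrite -[p _]mulr1 -[X in homog X]addn0; apply: homog_pM homog_1. Qed.

Lemma reduced_prod1 (ga : intpartn 1) : reduced_prod ga = 1.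
Proof.
have := sumn_intpartn ga; have := intpartn_neq0 ga.
case: (ga : seq nat) => [|k s] //; rewrite inE negb_or => /andP[k0 s0] /= ks.
have := size_le_sumn s0; have [-> ->] : k = 1%N /\ sumn s = 0%N by lia.
by rewrite leqn0 => /nilP ->; rewrite /= big_ord0 mulr1.
Qed.

(** Induction along (n+1) q_(n+1) = Omega_1(q_n): the edges into gb contribute the
    reduced content product of gb times edge ga gb / sqnorm ga, and [sum_edge]
    adds up the latter. *)
Lemma B_qsum n (ga : intpartn n.+1) : B (qsum n.+1) (J ga) = reduced_prod ga.
Proof.
elim: n ga => [|n IH] gb.
  rewrite -jackg1 -[jackg 1]mulr1 -jackg_prod0 -jackg_prod_cons (B_jackg1n gb).
  by rewrite reduced_prod1.
apply: (mulfI (char0 n.+1)); rewrite BC -[LHS]linearZ /= -omega1_qsum BC.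
have [_ ->] := symbol_omega1; rewrite -(sum_edge gb) mulr_suml; apply: eq_bigr => ga _.
rewrite IH; have := edge_reduced_prod ga gb (ltn0Sn n).
move: (reduced_prod ga) (reduced_prod gb) (content_jump ga gb) (edge ga gb) => a b t e h.
have -> : e / sqnorm ga * b = b * e / sqnorm ga by ring.
by rewrite -h; ring.
Qed.

Definition omega k := iter k.-1 (bracket delta) omega1.

Lemma omega1_scale c f : omega1 (c *: f) = c *: omega1 f.
Proof. by rewrite !omega1E linearZ. Qed.

Lemma delta_scale c f : delta (c *: f) = c *: delta f.
Proof. by rewrite /delta /bracket omega1_scale [D (c *: f)]linearZ /= [D (c *: _)]linearZ /= omega1_scale [RHS]scalerBr. Qed.

Lemma omega_scale k c f : omega k (c *: f) = c *: omega k f.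
Proof.
rewrite /omega; elim: k.-1 f => [|m IH] f /=; first exact: omega1_scale.
by rewrite /bracket IH !delta_scale IH [RHS]scalerBr.
Qed.

(** Induction on k by (k+1) q_(k+1) = [Omega_1, q_k], each factor passing through
    Phi in turn. *)
Lemma content_op_qsumM k n f : (0 < n)%N ->
  content_op (k.+1 + n) (qsum k.+1 * f) = k.+1`!%:R^-1 *: omega k.+1 (content_op n f).
Proof.
elim: k n f => [|k IH] n f n_gt0; first by rewrite add1n content_op_qsum1 // invr1 scale1r.
have kn : (0 < k.+1 + n)%N by rewrite addn_gt0.
have -> : qsum k.+2 * f = k.+2%:R^-1 *: (omega1 (qsum k.+1 * f) - qsum k.+1 * omega1 f).
  by rewrite omega1_qsumM addrK scalerA mulVf ?scale1r // char0.
rewrite linearZ linearB /= addSn content_op_omega1 // -addnS !IH // content_op_omega1 // delta_scale.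
by rewrite -scalerBr scalerA -invfM -natrM -factS.
Qed.

(** The degree 0 exception to [content_op_qsumM]: here the commutator reduces to
    Omega_1(q_k), as Omega_1 annihilates 1. *)
Lemma content_op_qsum k : content_op k.+1 (qsum k.+1) = k.+1`!%:R^-1 *: iter k delta (qsum 1).
Proof.
elim: k => [|k IH].
  rewrite invr1 scale1r; apply: homog_ext => [||ga]; [exact: homog_content_op|exact: homog_qsum|].
  by rewrite B_content_op !B_qsum reduced_prod1 mulr1.
have -> : qsum k.+2 = k.+2%:R^-1 *: omega1 (qsum k.+1).
  by rewrite omega1_qsum scalerA mulVf ?scale1r // char0.
by rewrite linearZ /= content_op_omega1 // IH delta_scale scalerA -invfM -natrM -factS.
Qed.

Lemma content_op_prod (k : nat) (s : seq nat) : 0%N \notin k :: s ->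
  content_op (sumn (k :: s)) (\prod_(i <- k :: s) qsum i)
  = (\prod_(i <- k :: s) i`!)%N%:R^-1 *:
    (\big[comp/id]_(i <- s) omega i) (iter k.-1 delta (qsum 1)).
Proof.
rewrite inE negb_or; case: k => // k /= s0.
elim: s s0 => [|[|i] s IH] s0; rewrite ?inE // in s0 *.
  by rewrite !big_seq1 big_nil addn0 content_op_qsum.
have -> : (k.+1 + (i.+1 + sumn s) = i.+1 + (k.+1 + sumn s))%N by lia.
rewrite !big_cons mulrCA content_op_qsumM; last by lia.
have := IH s0; rewrite !big_cons /= => ->.
rewrite omega_scale scalerA; congr (_ *: _).
by rewrite mulnCA [in RHS]natrM invfM.
Qed.
Lemma homog_orth m n f h : homog m f -> homog n h -> m != n -> B f h = 0.
Proof.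
move=> hf hh ne; rewrite (J_expand _ hh) big1 // => la _.
rewrite [B f _]BC (J_expand _ hf) big1 ?mulr0 // => mu _; rewrite J_orth ?mulr0 // => e.
by move/eqP: ne; rewrite -(sumn_intpartn mu) -(sumn_intpartn la) e.
Qed.

Lemma homog_prod_p s : 0%N \notin s -> homog (sumn s) (\prod_(k <- s) p k).
Proof.
elim: s => [|[|k] s IH]; rewrite ?inE //; first by rewrite big_nil => _; apply: homog_1.
by move=> s0; rewrite big_cons; apply/homog_pM/IH.
Qed.

(** The Cauchy kernel is reproducing: both sides satisfy the same recursion when f
    is multiplied by p_k. *)
Lemma coef_eval (I : finType) (c : (I -> nat) -> A -> K) :
    (forall e x f h, c e (x *: f + h) = x * c e f + c e h) ->
    (forall e, c e 1 = [forall i, e i == 0%N]%:R) ->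
    (forall e k f, c e (p k.+1 * f) = \sum_i
       if (k < e i)%N then c (fun j => e j - (i == j) * k.+1)%N f else 0) ->
  forall f e, c e f = B f (\prod_i jackg (e i)).
Proof.
move=> c_lin c_1 c_p f; elim/A_ind: f => [x f h Hf Hh|e|k f Hf] => [e||e].
- by rewrite c_lin Hf Hh ![B _ (\prod_i _)]BC linearP.
- rewrite c_1 -(big_map e xpredT jackg) -/(jackg_prod _).
  case: forallP => [e0|ne].
    rewrite -[X in jackg_prod X]filter_predT (@eq_map _ _ e (fun=> 0%N)); last first.
      by move=> i; apply/eqP.
    rewrite /jackg_prod big_filter big_map big1 ?B_11 // => i _; exact: jackg0.
  apply/esym; apply/eqP/negPn/negP => /homog_1/eqP; rewrite sumnE big_map.
  by rewrite sum_nat_eq0 => /forallP e0; apply: ne => i; apply: e0.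
- rewrite c_p B_pM d_prod ?index_enum_uniq // linear_sum mulr_sumr.
  apply: eq_bigr => i _; rewrite d_jackg -scalerAl linearZ /= mulrA mulfV ?mul1r; last first.
    by rewrite mulf_neq0 ?alpha_neq0 ?char0.
  rewrite /jackg_shift; case: ifP => [_|_]; last by rewrite mul0r linear0.
  rewrite Hf (bigD1 i) //= eqxx mul1n; congr (B _ (_ * _)).
  by apply: eq_bigr => j ne; rewrite eq_sym (negPf ne) subn0.
Qed.

Lemma content_opE n f : (0 < n)%N -> content_op n f =
  \sum_(ga : intpartn n) (B (qsum n) (J ga) * B f (J ga) / sqnorm ga) *: J ga.
Proof.
by case: n => // n _; apply: eq_bigr => ga _; rewrite B_qsum mulrAC.
Qed.

End FockSpace.

(** * Evaluation in finitely many variables *)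

Section Substitution.
Variables (K : fieldType) (S : comAlgType K) (y : nat -> S).

Lemma semilinear_step (A : comAlgType K) (phi : {linear A -> S}) (p : A) z c f h :
    phi (p * f) = z * phi f -> phi (p * h) = z * phi h ->
  phi (p * (c *: f + h)) = z * phi (c *: f + h).
Proof.
by move=> Hf Hh; rewrite mulrDr -scalerAr !linearP Hf Hh mulrDr -scalerAr.
Qed.

Definition mono_at (m : {cmonom nat}) : S := \prod_(i <- finsupp m) y i.+1 ^+ m i.

Lemma monoEw (X : {fset nat}) (m : {cmonom nat}) : (finsupp m `<=` X)%fset ->
  mono_at m = \prod_(i <- X) y i.+1 ^+ m i.
Proof.
move=> mX; rewrite /mono_at (big_fset_incl _ mX) //= => i _ /=.
by rewrite -cmE_eq0 => /eqP ->.
Qed.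

Lemma monoM m k : mono_at (mmul m (ucm k)) = y k.+1 * mono_at m.
Proof.
pose X := finsupp (mmul m (ucm k)).
have kX : k \in X by rewrite -cmE_neq0 cmM cmUU addn1.
rewrite (@monoEw X m); last by apply/fsubsetP => i; rewrite -!cmE_neq0 cmM; case: (m i).
rewrite (@monoEw X) // (bigD1_seq k) ?fset_uniq //= [in RHS](bigD1_seq k) ?fset_uniq //=.
rewrite cmM cmUU addn1 exprS -mulrA; congr (_ * (_ * _)).
by apply: eq_bigr => i ne; rewrite cmM cmU eq_sym (negPf ne) addn0.
Qed.

Lemma psubst_is_linear : linear (psubst y : symf K -> S).
Proof.
move=> c f h; rewrite /psubst -/mono_at.
pose X := (msupp f `|` msupp h `|` msupp (c *: f + h))%fset.
rewrite (@mmapEw _ _ _ _ _ X); last exact: fsubsetUr.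
rewrite (@mmapEw _ _ _ _ _ X f); last by rewrite /X -fsetUA fsubsetUl.
rewrite (@mmapEw _ _ _ _ _ X h); last by rewrite /X fsubsetU // fsubsetUr.
rewrite scaler_sumr -big_split; apply: eq_bigr => m _ /=.
rewrite [X in X%:A * _]coefD [X in (X + _)%:A * _]coefZ scalerDl mulrDl.
by rewrite -!scalerAl !mul1r scalerA.
Qed.

HB.instance Definition _ :=
  GRing.isLinear.Build K (symf K) S *:%R (psubst y) psubst_is_linear.

Lemma psubst_mon m : psubst y (<< m >> : symf K) = mono_at m.
Proof. by rewrite [LHS]mmapU /= scale1r mul1r. Qed.

Lemma psubst1 : psubst y 1 = 1.
Proof.
have := psubst_mon mone; rewrite /mono_at mdom1 big_seq_fset0; exact.
Qed.

Lemma psubst_psumM k (f : symf K) : psubst y (psum k.+1 * f) = y k.+1 * psubst y f.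
Proof.
elim/symf_mon_ind: f => [c f h Hf Hh|m].
  exact: (@semilinear_step _ (psubst y) _ _ c f h Hf Hh).
by rewrite [X in psubst y X]psumM_mon [LHS]psubst_mon [X in _ = _ * X]psubst_mon monoM.
Qed.

Lemma psubst_psum_part s : 0%N \notin s ->
  psubst y (psum_part s) = \prod_(k <- s) y k.
Proof.
rewrite /psum_part; elim: s => [|[|k] s IH]; rewrite ?inE //.
  by rewrite !big_nil => _; exact: psubst1.
by move=> s0; rewrite !big_cons psubst_psumM IH.
Qed.

End Substitution.

Section Monomials.
Variables (K : fieldType) (N : nat).
Implicit Types (e : {cmonom 'I_N}) (F : {malg K[{cmonom 'I_N}]}).

Lemma mcoeff_varM (i : 'I_N) F e : (<< ucm i >> * F)@_e
  = if (0 < e i)%N then F@_(divcm e (ucm i)) else 0.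
Proof.
rewrite malgM_def fgmulUg raddf_sum /=.
rewrite (eq_bigr (fun m => F@_m *+ (mmul (ucm i) m == e))); last first.
  by move=> m _; rewrite mcoeffU mul1r.
case: ifP => [ei|/negbT]; last first.
  rewrite -eqn0Ngt => /eqP ei; apply: big1 => m _.
  by case: eqP => // /(congr1 (fun m : {cmonom 'I_N} => m i)); rewrite cmM cmUU ei.
rewrite [in RHS](monalgE F) raddf_sum /=; apply: eq_bigr => m _.
rewrite mcoeffU; congr (_ *+ nat_of_bool _); apply/eqP/eqP => [<-|->].
  by apply/eqP/cmP => j; rewrite divcmE cmM addKn.
apply/eqP/cmP => j; rewrite cmM divcmE cmU.
by case: eqP => [<-|_]; rewrite ?subnKC ?subn0.
Qed.

Definition expvec (h : 'I_N -> nat) : {cmonom 'I_N} :=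
  \big[mmul/mone]_(i < N) iter (h i) (mmul (ucm i)) mone.

Lemma iter_ucmE (i j : 'I_N) k :
  (iter k (mmul (ucm i)) mone : {cmonom 'I_N}) j = ((i == j) * k)%N.
Proof.
elim: k => [|k IH] /=; first by rewrite cm1 muln0.
by rewrite cmM cmU IH mulnS.
Qed.

Lemma expvecE h j : expvec h j = h j.
Proof.
have E (r : seq 'I_N) : (\big[mmul/mone]_(i <- r) iter (h i) (mmul (ucm i)) mone
     : {cmonom 'I_N}) j = (\sum_(i <- r) (i == j) * h i)%N.
  elim: r => [|i r IH]; first by rewrite !big_nil cm1.
  by rewrite !big_cons cmM IH iter_ucmE.
rewrite /expvec E (bigD1 j) //= eqxx mul1n big1 ?addn0 // => i /negPf ->.
by [].
Qed.

Lemma prod_varX (h : 'I_N -> nat) :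
  \prod_(i < N) << ucm i >> ^+ h i = << expvec h >> :> {malg K[{cmonom 'I_N}]}.
Proof.
rewrite /expvec; elim: (index_enum _) => [|i r IH]; first by rewrite !big_nil.
rewrite !big_cons IH -malgUM; congr (_ * _).
elim: (h i) => [|k IHk]; first exact: expr0.
by rewrite [LHS]exprS IHk; exact: malgUM.
Qed.

Lemma mcoeff_varXM (i : 'I_N) k F e : (<< ucm i >> ^+ k * F)@_e
  = if (k <= e i)%N then F@_(expvec (fun j => e j - (i == j) * k)%N) else 0.
Proof.
elim: k e => [|k IH] e.
  rewrite expr0 mul1r leq0n; congr (F@_ _); apply/eqP/cmP => j.
  by rewrite expvecE muln0 subn0.
rewrite exprS -mulrA mcoeff_varM IH divcmE cmUU.
case: (e i) (erefl (e i)) => [|m] Em //=; rewrite subSS subn0 ltnS.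
case: ifP => // km; congr (F@_ _); apply/eqP/cmP => j.
by rewrite !expvecE divcmE cmU mulnS subnDA.
Qed.

(** At most one term of the sum defining the monomial function has a given
    exponent vector. *)
Lemma monomial_evalE (mu : seq nat) (h : 'I_N -> nat) :
  (monomial_eval K N mu)@_(expvec h)
  = (perm_eq [seq k <- [seq h i | i <- enum 'I_N] | k != 0%N] mu)%:R.
Proof.
rewrite /monomial_eval raddf_sum /=.
have E (e : {ffun 'I_N -> 'I_(sumn mu).+1}) :
    (\prod_(i < N) << ucm i >> ^+ e i : {malg K[{cmonom 'I_N}]})@_(expvec h)
    = [forall i, e i == h i :> nat]%:R.
  rewrite (prod_varX (fun i => e i)) mcoeffU1; congr (nat_of_bool _)%:R.
  apply/eqP/forallP => [eh i|eh].
    by rewrite -(expvecE h i) -eh expvecE.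
  by apply/eqP/cmP => i; rewrite !expvecE; apply/eqP.
rewrite (eq_bigr _ (fun (e : {ffun _ -> _}) _ => E e)) {E}.
case: (boolP (perm_eq _ _)) => [hmu|nmu]; last first.
  rewrite big1 // => e pe; case: forallP => // eh; case/negP: nmu.
  rewrite -(@eq_map _ _ (fun i => val (e i)) h) // => i; exact/eqP/eh.
have le_h i : (h i < (sumn mu).+1)%N.
  case: (posnP (h i)) => [-> //|h_gt0]; rewrite ltnS.
  have hi : h i \in mu.
    by rewrite -(perm_mem hmu) mem_filter -lt0n h_gt0 map_f ?mem_enum.
  rewrite (perm_sumn (perm_to_rem hi)) /=; exact: leq_addr.
pose e0 : {ffun 'I_N -> 'I_(sumn mu).+1} := [ffun i => Ordinal (le_h i)].
have e0E i : e0 i = h i :> nat by rewrite ffunE.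
rewrite (bigD1 e0) /=; last by rewrite (@eq_map _ _ (fun i => val (e0 i)) h).
rewrite big1 ?addr0 => [|e /andP[_ ne]].
  by case: forallP => // -[] i; rewrite e0E.
case: forallP => // eh; case/eqP: ne; apply/ffunP => i; apply: val_inj.
by rewrite /= e0E; apply/eqP/eh.
Qed.

End Monomials.

(** * Three alphabets *)

Section Tensor.
Variable K : fieldType.

Definition emb (i : 'I_3) (s : seq nat) : {cmonom ('I_3 * nat)%type} :=
  \big[mmul/mone]_(k <- s) ucm (i, k.-1).

Lemma embE i s j k : 0%N \notin s ->
  emb i s (j, k) = ((i == j) * count_mem k.+1 s)%N.
Proof.
rewrite /emb; elim: s => [|[|l] s IH]; rewrite ?inE //.
  by rewrite big_nil cm1 muln0.
move=> s0; rewrite big_cons cmM cmU IH //= xpair_eqE eqSS.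
by case: (i == j); rewrite ?mul1n.
Qed.

Lemma in_alphabet_psum_part i s : 0%N \notin s ->
  in_alphabet i (psum_part s : symf K) = << emb i s >>.
Proof.
move=> s0; rewrite /in_alphabet [LHS](psubst_psum_part _ s0) /emb.
elim: s {s0} => [|k s IH]; first by rewrite !big_nil.
by rewrite big_cons IH [in RHS]big_cons; exact: malgUM.
Qed.

(** The monomial in three alphabets that is p_s(x) p_t(y) p_u(z). *)
Definition tensor_mon s t u : {cmonom ('I_3 * nat)%type} :=
  mmul (mmul (emb (inord 0) s) (emb (inord 1) t)) (emb (inord 2) u).

Lemma tensor3_psum_part s t u : 0%N \notin s -> 0%N \notin t -> 0%N \notin u ->
  tensor3 (psum_part s : symf K) (psum_part t) (psum_part u) = << tensor_mon s t u >>.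
Proof.
move=> s0 t0 u0; rewrite /tensor3 !in_alphabet_psum_part //.
rewrite [X in X * _]malgUM; exact: malgUM.
Qed.

Lemma monom_of_eq s s' : 0%N \notin s -> 0%N \notin s' ->
  reflect (forall k, count_mem k.+1 s = count_mem k.+1 s') (monom_of s == monom_of s').
Proof.
move=> s0 s0'; apply: (iffP (cmP _ _)) => h k; have := h k; rewrite !monom_ofE //.
Qed.

Lemma tensor_mon_eq s t u s' t' u' :
    0%N \notin s -> 0%N \notin t -> 0%N \notin u ->
    0%N \notin s' -> 0%N \notin t' -> 0%N \notin u' ->
  (tensor_mon s t u == tensor_mon s' t' u')
  = [&& monom_of s == monom_of s', monom_of t == monom_of t'
      & monom_of u == monom_of u'].
Proof.
move=> s0 t0 u0 s0' t0' u0'; apply/cmP/and3P => [h|[]].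
  have hk i k := h (i, k); split; apply/monom_of_eq => // k;
    [have := hk (inord 0) k|have := hk (inord 1) k|have := hk (inord 2) k];
  by rewrite !(cmM, embE) // -!val_eqE /= !inordK // !mul0n !mul1n ?addn0 ?add0n.
move=> /(monom_of_eq s0 s0') hs /(monom_of_eq t0 t0') ht /(monom_of_eq u0 u0') hu [i k].
by rewrite !(cmM, embE) // hs ht hu.
Qed.

Lemma bilinear_step (A S : comAlgType K) (phi : {linear A -> S}) (psi : S -> K) (y : S)
    (c : K) f h : (forall c a b, psi (c *: a + b) = c * psi a + psi b) ->
  psi (y * phi (c *: f + h)) = c * psi (y * phi f) + psi (y * phi h).
Proof. by move=> psi_lin; rewrite linearP mulrDr -scalerAr psi_lin. Qed.

Let coef3 (m : {cmonom ('I_3 * nat)%type}) (F : symf3 K) : K := F@_m.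

Let coef3_lin m c F G : coef3 m (c *: F + G) = c * coef3 m F + coef3 m G.
Proof. by rewrite /coef3 [LHS]mcoeffD [X in X + _]mcoeffZ. Qed.

Let in_alph (i : 'I_3) : {linear symf K -> symf3 K} :=
  psubst (fun k => << ucm (i, k.-1) >> : symf3 K).

Lemma mcoeff_tensor3 s t u (f h k : symf K) :
    0%N \notin s -> 0%N \notin t -> 0%N \notin u ->
  (tensor3 f h k)@_(tensor_mon s t u)
  = f@_(monom_of s) * h@_(monom_of t) * k@_(monom_of u).
Proof.
move=> s0 t0 u0.
have T1 x y z : tensor3 x y z = in_alph (inord 1) y * in_alph (inord 2) z * in_alph (inord 0) x.
  by rewrite /tensor3 -[LHS]mulrA [LHS]mulrC.
have T2 x y z : tensor3 x y z = in_alph (inord 0) x * in_alph (inord 2) z * in_alph (inord 1) y.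
  by rewrite /tensor3 [LHS]mulrAC.
have T3 x y z : tensor3 x y z = in_alph (inord 0) x * in_alph (inord 1) y * in_alph (inord 2) z.
  exact: erefl.
rewrite -/(coef3 _ _).
elim/symf_mon_ind: f => [c f f' Hf Hf'|m].
  have -> : coef3 (tensor_mon s t u) (tensor3 (c *: f + f') h k) = c * coef3 (tensor_mon s t u) (tensor3 f h k)
      + coef3 (tensor_mon s t u) (tensor3 f' h k).
    rewrite (T1 (c *: f + f') h k) (T1 f h k) (T1 f' h k).
    exact: (@bilinear_step _ _ (in_alph _) _ _ c f f' (coef3_lin _)).
  etransitivity; first exact: (congr2 (fun a b : K => c * a + b) Hf Hf').
  by rewrite [X in _ = X * _ * _]coefD [X in _ = (X + _) * _ * _]coefZ; ring.
elim/symf_mon_ind: h => [c f f' Hf Hf'|m'].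
  have -> : coef3 (tensor_mon s t u) (tensor3 << m >> (c *: f + f') k) = c * coef3 (tensor_mon s t u) (tensor3 << m >> f k)
      + coef3 (tensor_mon s t u) (tensor3 << m >> f' k).
    rewrite (T2 _ (c *: f + f') k) (T2 _ f k) (T2 _ f' k).
    exact: (@bilinear_step _ _ (in_alph _) _ _ c f f' (coef3_lin _)).
  etransitivity; first exact: (congr2 (fun a b : K => c * a + b) Hf Hf').
  by rewrite [X in _ = _ * X * _]coefD [X in _ = _ * (X + _) * _]coefZ; ring.
elim/symf_mon_ind: k => [c f f' Hf Hf'|m''].
  have -> : coef3 (tensor_mon s t u) (tensor3 << m >> << m' >> (c *: f + f')) = c * coef3 (tensor_mon s t u) (tensor3 << m >> << m' >> f)
      + coef3 (tensor_mon s t u) (tensor3 << m >> << m' >> f').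
    rewrite (T3 _ _ (c *: f + f')) (T3 _ _ f) (T3 _ _ f').
    exact: (@bilinear_step _ _ (in_alph _) _ _ c f f' (coef3_lin _)).
  etransitivity; first exact: (congr2 (fun a b : K => c * a + b) Hf Hf').
  rewrite [X in _ = _ * X]coefD [X in _ = _ * (X + _)]coefZ [RHS]mulrDr.
  apply: (f_equal (fun a : K => a + _)); exact: mulrCA.
have [z0 z1 z2] := And3 (mon_parts_neq0 m) (mon_parts_neq0 m') (mon_parts_neq0 m'').
rewrite -!psum_part_mon_parts tensor3_psum_part // /coef3 [LHS]mcoeffU1.
rewrite !psum_part_mon_parts [X in _ = X * _ * _]mcoeffU1 [X in _ = _ * X * _]mcoeffU1.
rewrite [X in _ = _ * X]mcoeffU1 tensor_mon_eq // !mon_partsK -!natrM !mulnb.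
by rewrite andbA.
Qed.

End Tensor.

(** * Jack functions *)

Lemma iter_ext (T : Type) (F G : T -> T) m x y :
  F =1 G -> x = y -> iter m F x = iter m G y.
Proof. by move=> FG ->; elim: m => //= m ->. Qed.

Lemma big_comp_ext (T : Type) (F G : nat -> T -> T) s x y :
    (forall i, F i =1 G i) -> x = y ->
  (\big[comp/id]_(i <- s) F i) x = (\big[comp/id]_(i <- s) G i) y.
Proof.
move=> FG ->; elim: s => [|i s IH]; first by rewrite !big_nil.
by rewrite !big_cons /= IH FG.
Qed.

Section Jack.
Variables (K : fieldType) (alpha : K).
Hypothesis char0 : forall n, n.+1%:R != 0 :> K.
Hypothesis alpha_neq0 : alpha != 0.

Let A : comAlgType K := symf K.
Let p : nat -> A := psum.
Let d (k : nat) : {linear A -> A} := dpsum k.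
Let B (f : A) : {linear A -> K^o} := jack_scalar alpha f.
Let D : A -> A := laplace_beltrami alpha.

Let A_ind : forall P : A -> Prop,
    (forall c f h, P f -> P h -> P (c *: f + h)) -> P 1 ->
    (forall k f, P f -> P (p k.+1 * f)) ->
  forall f, P f := @symf_ind K.
Let d_1 k : d k.+1 1 = 0 := dpsum1 K k.+1.
Let d_pM k j f : d k.+1 (p j.+1 * f) = (k == j)%:R *: f + p j.+1 * d k.+1 f :=
  dpsum_psumM k j f.
Let BC f h : B f h = B h f := jack_scalarC alpha f h.
Let B_pM k f h : B (p k.+1 * f) h = alpha * k.+1%:R * B f (d k.+1 h) :=
  jack_scalar_psumM alpha k f h.
Let B_11 : B 1 1 = 1 := jack_scalar11 alpha.

Lemma symf_eval_coef N (e : 'I_N -> nat) (f : symf K) :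
  (symf_eval N f)@_(expvec e) = B f (\prod_(i < N) jackg alpha p (e i)).
Proof.
have c_eq (e1 e2 : 'I_N -> nat) : e1 =1 e2 -> expvec e1 = expvec e2.
  by move=> e12; apply/eqP/cmP => i; rewrite !expvecE.
pose c (e : 'I_N -> nat) (f : A) := (symf_eval N f)@_(expvec e).
apply: (coef_eval char0 alpha_neq0 A_ind d_1 d_pM BC B_pM B_11 (c := c)) => {e f} [e x f h|e|e k f].
- rewrite /c /symf_eval [X in X@_ _ = _](psubst_is_linear _ x f h).
  by rewrite [LHS]mcoeffD [X in X + _]mcoeffZ.
- rewrite /c /symf_eval [X in X@_ _ = _]psubst1 [LHS]mcoeff1.
  congr (nat_of_bool _)%:R; apply/eqP/forallP => [e1 i|e0].
    by rewrite -(expvecE e i) e1 cm1.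
  by apply/eqP/cmP => i; rewrite expvecE cm1; apply/eqP.
- rewrite /c /symf_eval [X in X@_ _ = _]psubst_psumM [X in X@_ _ = _]mulr_suml.
  rewrite [LHS]raddf_sum /=; apply: eq_bigr => i _.
  rewrite [LHS]mcoeff_varXM expvecE; case: ifP => // _.
  by congr (_@_ _); apply: c_eq => j; rewrite expvecE.
Qed.

(** As many variables as s has entries are enough to see the exponent vector s. *)
Lemma monomial_expansion_coef n (f : symf K) (c : intpartn n -> K) s :
  monomial_expansion f c -> B f (jackg_prod alpha p s)
    = \sum_(mu : intpartn n) c mu * (perm_eq [seq k <- s | k != 0%N] mu)%:R.
Proof.
move=> fc; pose e (i : 'I_(size s)) := nth 0%N s i.
have es : [seq e i | i <- enum 'I_(size s)] = s.
  rewrite -[RHS](mkseq_nth 0%N) /mkseq -val_enum_ord -map_comp.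
  exact: eq_map.
transitivity ((symf_eval (size s) f)@_(expvec e)).
  rewrite symf_eval_coef -{1}es /jackg_prod big_map enumT; congr (B _ _).
rewrite fc [LHS]raddf_sum /=; apply: eq_bigr => mu _.
by rewrite [LHS]mcoeffZ monomial_evalE es.
Qed.

Variables (J : forall n, intpartn n -> symf K) (HJ : is_jack alpha J).

Lemma jack_dominated n (la : intpartn n) s :
  B (J la) (jackg_prod alpha p s) != 0 -> sumn s = n /\ dominated s la.
Proof.
have [c [/monomial_expansion_coef e tri _]] := jack_triangular HJ la.
rewrite (e s) => /big_neq0_ex[mu]; rewrite mulf_eq0 negb_or => /andP[cmu].
case: (boolP (perm_eq _ _)) => [s_mu _|]; last by rewrite eqxx.
have [so _ sn] := intpartnP mu; split; last first.
  exact: dominated_trans (dominated_sort so s_mu) (tri _ cmu).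
rewrite -sn -(perm_sumn s_mu); elim: (s) => //= -[|k] t IH //=.
by rewrite IH.
Qed.

(** The coefficient of x_1 ... x_n is n!. *)
Lemma jack_col n (la : intpartn n) : B (J la) (jackg_prod alpha p (nseq n 1%N)) = n`!%:R.
Proof.
have [c [/monomial_expansion_coef e _ cn]] := jack_triangular HJ la.
rewrite (e _) (bigD1 (col_partn n)) //= filter_nseq /= mul1n perm_refl mulr1 cn.
rewrite big1 ?addr0 // => mu ne; case: (boolP (perm_eq _ _)) => [h|_]; last exact: mulr0.
case/eqP: ne; apply: intpartn_inj => /=; have [so _ _] := intpartnP mu.
have [so' _ _] := intpartnP (col_partn n).
apply: (sorted_eq geq_trans) => //; last by rewrite perm_sym.
by move=> x y /=; rewrite andbC -eqn_leq => /eqP.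
Qed.

Hypothesis anisotropic : forall f : symf K, jack_scalar alpha f f = 0 -> f = 0.
Hypothesis alpha_transc : forall a b a' b' : nat,
  alpha * a%:R - b%:R = alpha * a'%:R - b'%:R -> b = b'.

Let D_uptoE f : exists N0, forall N, (N0 <= N)%N -> D f = D_upto alpha p d N f.
Proof. by exists (psum_bound f) => N; apply: laplace_beltramiE. Qed.

Let content_op := content_op alpha B J.

Lemma jack_content_op_prod (k : nat) (s : seq nat) : 0%N \notin k :: s ->
  content_op (sumn (k :: s)) (\prod_(i <- k :: s) qsum alpha p i)
  = (\prod_(i <- k :: s) i`!)%N%:R^-1 *:
    (\big[comp/id]_(i <- s) omega alpha p D i) (iter k.-1 (delta alpha p D) (qsum alpha p 1)).
Proof.
exact: (content_op_prod char0 alpha_neq0 A_ind d_1 d_pM BC B_pM anisotropic D_uptoE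
  (jack_orthogonal HJ) jack_dominated jack_col alpha_transc).
Qed.

Lemma qsum1E : qsum alpha p 1 = p1_alpha alpha.
Proof. by rewrite /qsum mulr1. Qed.

Lemma omega1_Omega1 f : omega1 alpha p D f = Omega1 alpha f.
Proof. by rewrite /omega1 qsum1E. Qed.

Lemma delta_Delta f : delta alpha p D f = Delta alpha f.
Proof. by rewrite /delta /bracket !omega1_Omega1. Qed.

Lemma omega_Omega k f : omega alpha p D k f = Omega alpha k f.
Proof.
rewrite /omega /Omega; elim: k.-1 f => [|m IH] f; first exact: omega1_Omega1.
pose X := iter m (bracket (delta alpha p D)) (omega1 alpha p D).
pose Y := iter m (commutator (Delta alpha)) (Omega1 alpha).
have XY h : X h = Y h := IH h.
have e1 : delta alpha p D (X f) = Delta alpha (Y f).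
  exact: (etrans (delta_Delta (X f)) (congr1 (Delta alpha) (XY f))).
have e2 : X (delta alpha p D f) = Y (Delta alpha f).
  exact: (etrans (congr1 X (delta_Delta f)) (XY _)).
exact: (congr2 (fun a b : A => a - b) e1 e2).
Qed.

Lemma omega_word m s : (\big[comp/id]_(i <- s) omega alpha p D i)
    (iter m (delta alpha p D) (qsum alpha p 1))
  = (\big[comp/id]_(i <- s) Omega alpha i) (iter m (Delta alpha) (p1_alpha alpha)).
Proof.
by apply: big_comp_ext; [exact: omega_Omega|exact: iter_ext delta_Delta qsum1E].
Qed.

Lemma mweight_monom_of s : 0%N \notin s ->
  mweight alpha (monom_of s) = alpha ^+ size s * (z_part s)%:R.
Proof.
move=> s0; have e := perm_mon_parts s0.
by rewrite /mweight (perm_size e) (perm_z_part e).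
Qed.

Lemma jack_scalar_psum_partl s (f : symf K) : 0%N \notin s ->
  B (psum_part s) f = alpha ^+ size s * (z_part s)%:R * f@_(monom_of s).
Proof.
move=> s0; rewrite -mweight_monom_of // [X in B X _]psum_partE.
exact: jack_scalar_monl.
Qed.

Lemma z_part_gt0 s : 0%N \notin s -> (0 < z_part s)%N.
Proof.
move=> s0; rewrite /z_part big_seq; apply: prodn_cond_gt0 => i.
rewrite mem_undup muln_gt0 fact_gt0 andbT expn_gt0 => si.
by case: i si s0 => // ->.
Qed.

Lemma z_part_aut s : z_part s = (aut_part s * \prod_(k <- s) k)%N.
Proof.
rewrite /z_part /aut_part big_split /= mulnC; congr (_ * _)%N.
rewrite -[RHS]big_undup_iterop_count; apply: eq_bigr => i _.
by rewrite Monoid.iteropE; elim: (count_mem i s) => //= n IH; rewrite expnS IH.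
Qed.

Lemma weight_neq0 s : 0%N \notin s -> alpha ^+ size s * (z_part s)%:R != 0.
Proof.
by move=> s0; rewrite mulf_neq0 ?expf_neq0 // (natK_neq0 char0) ?z_part_gt0.
Qed.

Lemma monom_of_inj n (la mu : intpartn n) : monom_of la = monom_of mu -> la = mu.
Proof.
move=> e; have [so l0 _] := intpartnP la; have [so' m0 _] := intpartnP mu.
apply/intpartn_inj/(sorted_eq geq_trans) => //.
  by move=> x y /=; rewrite andbC -eqn_leq => /eqP.
have := perm_mon_parts l0; rewrite -/(monom_of la) e => h.
by apply: perm_trans (perm_mon_parts m0); rewrite perm_sym.
Qed.

Lemma homog_psum_expand n (f : symf K) : homog alpha p B n f ->
  f = \sum_(la : intpartn n) f@_(monom_of la) *: psum_part la.
Proof.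
move=> hf; apply/malgP => m; rewrite [RHS]raddf_sum /=.
have co (la : intpartn n) : (f@_(monom_of la) *: psum_part la : symf K)@_m
    = f@_(monom_of la) * (monom_of la == m)%:R.
  by rewrite [LHS]mcoeffZ [X in _ * X@_ _]psum_partE [X in _ * X]mcoeffU1.
rewrite (eq_bigr _ (fun la _ => co la)).
case: (eqVneq (sumn (mon_parts m)) n) => [mn|ne].
  have [la] := sort_partn mn.
  have /all_filterP -> : all (fun k => k != 0%N) (mon_parts m).
    by apply/allP => k km; apply: contraNneq (mon_parts_neq0 m) => <-.
  move=> e; have mE : monom_of la = m.
    rewrite -[RHS]mon_partsK; apply: perm_big; by rewrite perm_sym.
  rewrite (bigD1 la) //= mE eqxx mulr1 big1 ?addr0 // => mu ne.
  case: eqP => [e'|_]; last by rewrite mulr0.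
  by case/eqP: ne; apply: monom_of_inj; rewrite e' mE.
rewrite big1 => [|la _]; last first.
  case: eqP => [e|_]; last by rewrite mulr0.
  case/eqP: ne; rewrite -e (perm_sumn (perm_mon_parts (intpartn_neq0 la))).
  exact: sumn_intpartn.
have m0 := mon_parts_neq0 m.
have := jack_scalar_psum_partl f m0; rewrite mon_partsK.
rewrite (homog_orth char0 alpha_neq0 A_ind BC anisotropic (jack_orthogonal HJ) jack_dominated
  jack_col (homog_prod_p char0 alpha_neq0 A_ind d_1 d_pM BC B_pM m0) hf ne).
by move/esym/eqP; rewrite mulf_eq0 (negPf (weight_neq0 m0)) => /eqP.
Qed.

Lemma B_prod_qsum s (f : symf K) : 0%N \notin s ->
  B (\prod_(k <- s) qsum alpha p k) f = (aut_part s)%:R * f@_(monom_of s).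
Proof.
move=> s0; rewrite prod_qsum BC linearZ /= BC jack_scalar_psum_partl //.
have prod0 : (0 < \prod_(k <- s) k)%N.
  by rewrite big_seq; apply: prodn_cond_gt0 => -[|k] // /(negP s0).
have := natK_neq0 char0 prod0; have := expf_neq0 (size s) alpha_neq0.
rewrite z_part_aut natrM /GRing.scale /=.
move: (alpha ^+ _) (_ %:R) (_ %:R) (f@__) => x y z c x0 z0.
by field; rewrite x0 z0.
Qed.

Lemma B_qsum_row n (f : symf K) : (0 < n)%N ->
  B (qsum alpha p n) f = f@_(monom_of (row_partn n)).
Proof.
move=> n_gt0; have rE : row_partn n = [:: n] :> seq nat by rewrite /= n_gt0.
have := @B_prod_qsum [:: n] f; rewrite big_seq1 inE eq_sym -lt0n => /(_ n_gt0) ->.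
by rewrite rE /aut_part /= big_seq1 /= eqxx mul1r.
Qed.

Variables (a : forall n, intpartn n -> intpartn n -> intpartn n -> K).
Hypothesis Ha : is_jack_structure_coef alpha J a.

(** The coefficient of p_la(x) p_mu(y) p_nu(z) on both sides of the defining
    identity of the structure coefficients. *)
Lemma structure_coef n (la mu nu : intpartn n) :
  \sum_(ga : intpartn n) (B (J ga) (J ga))^-1 *
     ((J ga)@_(monom_of la) * (J ga)@_(monom_of mu) * (J ga)@_(monom_of nu))
  = alpha ^- size la * (z_part la)%:R^-1 * a la mu nu.
Proof.
pose M := tensor_mon la mu nu.
have co c (f h k : symf K) : (c *: tensor3 f h k)@_M
    = c * (f@_(monom_of la) * h@_(monom_of mu) * k@_(monom_of nu)).
  by rewrite [LHS]mcoeffZ mcoeff_tensor3 ?intpartn_neq0.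
have pc (ka ka' : intpartn n) : (psum_part ka : symf K)@_(monom_of ka') = (ka == ka')%:R.
  rewrite [X in X@_ _]psum_partE [LHS]mcoeffU1; congr (nat_of_bool _)%:R.
  by apply/eqP/eqP => [/monom_of_inj|->].
have /(congr1 (fun F : symf3 K => F@_M)) := Ha n.
rewrite [X in X = _ -> _]raddf_sum [X in _ = X -> _]raddf_sum /=.
under eq_bigr do rewrite co.
move=> ->; rewrite (bigD1 la) //= [X in _ + X]big1 ?addr0 => [|la' ne].
  rewrite raddf_sum (bigD1 mu) //= [X in _ + X]big1 ?addr0 => [|mu' ne].
    rewrite raddf_sum (bigD1 nu) //= [X in _ + X]big1 ?addr0 => [|nu' ne].
      by rewrite co !pc !eqxx !mulr1.
    by rewrite co !pc (negPf ne) !mulr0.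
  rewrite raddf_sum big1 //= => nu' _.
  by rewrite co !pc (negPf ne) mulr0 mul0r mulr0.
rewrite raddf_sum big1 // => mu' _; rewrite raddf_sum big1 //= => nu' _.
by rewrite co !pc (negPf ne) !mul0r mulr0.
Qed.

(** Sum [structure_coef] against p_la: the first Jack factor is restored
    ([homog_psum_expand]), and the other two become pairings with q_n and with
    the product of the q_(nu_i). *)
Lemma series_content_op n (nu : intpartn n) : (0 < n)%N ->
  (aut_part nu)%:R *:
    (\sum_(la : intpartn n)
       ((z_part la)%:R^-1 * alpha ^- size la * a la (row_partn n) nu)
         *: psum_part la)
  = content_op n (\prod_(k <- nu) qsum alpha p k).
Proof.
move=> n_gt0.
rewrite [RHS](content_opE char0 alpha_neq0 A_ind d_1 d_pM BC B_pM anisotropic D_uptoE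
  (jack_orthogonal HJ) jack_dominated jack_col alpha_transc) //.
pose x (ga : intpartn n) := (B (J ga) (J ga))^-1 *
  ((J ga)@_(monom_of (row_partn n)) * (J ga)@_(monom_of nu)).
transitivity ((aut_part nu)%:R *: \sum_(ga : intpartn n) x ga *: (J ga : A)).
  apply: (f_equal (fun F : A => _ *: F)).
  transitivity (\sum_(la : intpartn n) \sum_(ga : intpartn n)
      (x ga * (J ga)@_(monom_of la)) *: (psum_part la : A)).
    apply: eq_bigr => la _; rewrite -scaler_suml.
    apply: (f_equal (fun c : K => c *: (psum_part la : A))).
    rewrite [_^-1 * alpha ^- _]mulrC -structure_coef; apply: eq_bigr => ga _.
    by rewrite /x; ring.
  rewrite exchange_big; apply: eq_bigr => ga _.
  rewrite [X in _ = _ *: X](@homog_psum_expand n); last first.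
    exact: (homog_J jack_dominated).
  rewrite scaler_sumr; apply: eq_bigr => la _.
  by rewrite [RHS]scalerA.
rewrite scaler_sumr; apply: eq_bigr => ga _; rewrite [LHS]scalerA.
apply: (f_equal (fun c : K => c *: (J ga : A))).
rewrite B_qsum_row // B_prod_qsum ?intpartn_neq0 // /x /sqnorm.
move: ((B _ _)^-1) (_@_ _) (_@_ _) (_ %:R) => y z t w; ring.
Qed.

End Jack.

(** * Rational functions in the parameter *)

Section RationalFunctions.

Lemma fraction_denom (R : idomainType) (x : {fraction R}) :
  exists2 b : R, b != 0 & exists a, tofrac b * x = tofrac a.
Proof.
elim/quotW: x => y; exists (frac y).2; first exact: denom_ratioP.
exists (frac y).1; suff : FracField.mul (tofrac (frac y).2) (\pi y)%qT = tofrac (frac y).1.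
  exact.
rewrite !piE /FracField.mulf !numden_Ratio ?oner_eq0 //.
apply/eqmodP; rewrite /= FracField.equivfE !numden_Ratio ?oner_eq0 ?mul1r ?denom_ratioP //.
by rewrite mulr1.
Qed.

Lemma common_denom (I : eqType) (r : seq I) (F : I -> Qalpha) :
  exists2 b : {poly rat}, b != 0 &
    exists P : I -> {poly rat}, {in r, forall i, tofrac b * F i = tofrac (P i)}.
Proof.
elim: r => [|i r [b b0 [P HP]]]; first by exists 1; rewrite ?oner_neq0 //; exists (fun=> 0).
have [c c0 [a Ha]] := fraction_denom (F i).
exists (b * c); first by rewrite mulf_neq0.
exists (fun j => if j == i then b * a else c * P j) => j.
rewrite inE tofracM; case: eqP => [-> _|_ /= jr].
  by rewrite -mulrA Ha tofracM.
by rewrite mulrAC HP // tofracM mulrC.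
Qed.

(** Clear denominators and specialize alpha at the positive integers: a vanishing
    sum of nonnegative rationals has only zero terms, and a polynomial with
    infinitely many roots is 0. *)
Lemma sum_sq_eq0 (I : eqType) (r : seq I) (l z : I -> nat) (F : I -> Qalpha) :
    (forall i, 0 < z i)%N ->
    \sum_(i <- r) alpha ^+ l i * (z i)%:R * F i * F i = 0 ->
  {in r, forall i, F i = 0}.
Proof.
move=> z0 F0; have [b b0 [P HP]] := common_denom r F.
have S0 : \sum_(i <- r) 'X^(l i) * (z i)%:R * P i * P i = 0.
  apply/eqP; rewrite -tofrac_eq0 rmorph_sum; apply/eqP.
  transitivity (tofrac b * tofrac b * \sum_(i <- r) alpha ^+ l i * (z i)%:R * F i * F i).
    rewrite mulr_sumr; apply: eq_big_seq => i ir /=.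
    rewrite !tofracM tofracXn -!HP // -/alpha rmorph_nat; ring.
  by rewrite F0 mulr0.
move=> i ir; have fb0 : tofrac b != 0 by rewrite tofrac_eq0.
apply: (mulfI fb0); rewrite mulr0 HP //; apply/eqP; rewrite tofrac_eq0.
have Pn n : root (P i) n.+1%:R.
  have ev j : ('X^(l j) * (z j)%:R * P j * P j).[n.+1%:R]
      = n.+1%:R ^+ l j * (z j)%:R * (P j).[n.+1%:R] ^+ 2.
    by rewrite !hornerM hornerXn -polyC_natr hornerC -mulrA -expr2.
  have := congr1 (horner_eval n.+1%:R) S0; rewrite rmorph0 rmorph_sum /= => /eqP.
  rewrite psumr_eq0 => [/allP/(_ i ir)/=|j _]; rewrite /horner_eval ev; last first.
    by rewrite mulr_ge0 ?sqr_ge0 ?mulr_ge0 ?exprn_ge0 ?ler0n.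
  rewrite !mulf_eq0 !expf_eq0 !pnatr_eq0 andbF /= => /orP[|//].
    by rewrite eqn0Ngt z0.
  by rewrite orbb.
apply: contraT => Pi0.
have /max_poly_roots := Pi0; move/(_ [seq n.+1%:R | n <- iota 0 (size (P i))]).
rewrite size_map size_iota ltnn map_inj_uniq ?iota_uniq => [|m n /eqP]; last first.
  by rewrite eqr_nat eqSS => /eqP.
by apply=> //; apply/allP => x /mapP[n _ ->].
Qed.

Lemma Qalpha_char0 n : n.+1%:R != 0 :> Qalpha.
Proof. by rewrite -(rmorph_nat (@tofrac _)) tofrac_eq0 -polyC_natr polyC_eq0 pnatr_eq0. Qed.

Lemma Qalpha_alpha_neq0 : alpha != 0.
Proof. by rewrite tofrac_eq0 polyX_eq0. Qed.

Lemma Qalpha_transcendental (a b a' b' : nat) :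
  alpha * a%:R - b%:R = alpha * a'%:R - b'%:R -> b = b'.
Proof.
rewrite /alpha -!(rmorph_nat (@tofrac _)) -!rmorphM -!rmorphB => /eqP.
rewrite tofrac_eq => /eqP/(congr1 (horner_eval 0)).
rewrite /horner_eval !hornerE -?polyC_natr ?hornerC ?mul0r ?sub0r.
by move/oppr_inj/eqP; rewrite eqr_nat => /eqP.
Qed.

Lemma Qalpha_anisotropic (f : symf Qalpha) : jack_scalar alpha f f = 0 -> f = 0.
Proof.
move=> f0; apply/malgP => m; rewrite [RHS]mcoeff0.
case: (boolP (m \in msupp f)) => [mf|]; last exact: mcoeff_outdom.
apply: (sum_sq_eq0 (r := msupp f) (z := fun m => z_part (mon_parts m))
   (l := fun m => size (mon_parts m)) (F := fun m => f@_m) _ f0 mf).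
by move=> m'; apply/z_part_gt0/mon_parts_neq0.
Qed.

End RationalFunctions.

(** * The marginal sums *)

Theorem theorem1
    (J : forall n : nat, intpartn n -> symf Qalpha) (HJ : is_jack alpha J)
    (a : forall n : nat, intpartn n -> intpartn n -> intpartn n -> Qalpha)
    (Ha : is_jack_structure_coef alpha J a)
    (n : nat) (hn : (1 <= n)%N) (nu : intpartn n) :
  (aut_part nu)%:R *:
    (\sum_(lambda : intpartn n)
       ((z_part lambda)%:R^-1 * alpha ^- size lambda * a n lambda (row_partn n) nu)
         *: psum_part lambda)
  = ((\prod_(k <- nu) k`!)%N%:R : Qalpha)^-1 *:
      (\big[comp/id]_(k <- behead nu) Omega alpha k)
        (iter (head 0%N nu).-1 (Delta alpha) (p1_alpha alpha)).
Proof.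
have [_ n0 sn] := intpartnP nu.
rewrite (series_content_op Qalpha_char0 Qalpha_alpha_neq0 HJ Qalpha_anisotropic
  Qalpha_transcendental Ha) //.
case e: (nu : seq nat) n0 sn => [|k s] n0 sn; first by rewrite -sn in hn.
have := jack_content_op_prod Qalpha_char0 Qalpha_alpha_neq0 HJ Qalpha_anisotropic
  Qalpha_transcendental n0.
rewrite sn => phi_eq; apply: (etrans phi_eq).
apply: (f_equal (fun f : symf Qalpha => _ *: f)); exact: omega_word.
Qed.
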